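(* Let $G$ be a graph with maximum degree $\Delta$. Then $\mathrm{ch}'(G)=\Delta$ if at least one of the following holds: (1) $G$ has tree-width at most $3$ and $\Delta\ge 7$; (2) $G$ has path-width at most $3$ and $\Delta\ge 6$; (3) $G$ has path-width at most $4$ and $\Delta\ge 10$.
   Context: Graphs are finite and simple. An assignment of lists for a graph $G$ is a map $L:E(G)\to\mathcal P(\mathbb N)$. An $L$-edge-colouring of $G$ is a function $\mathcal C:E(G)\to\mathbb N$ with $\mathcal C(e)\in L(e)$ for each edge $e$ and such that no two adjacent edges (edges sharing an endpoint) receive the same colour. $G$ is $k$-edge-choosable if for each assignment of lists $L$ with $|L(e)|\ge k$ for all $e$ there is an $L$-edge-colouring. The list chromatic index $\mathrm{ch}'(G)$ is the smallest $k$ for which $G$ is $k$-edge-choosable. A tree decomposition $(T,\mathcal V)$ of $G$ consists of a tree $T$ and bags $\mathcal V=\{V_t\subset V(G): t\in V(T)\}$ such that $V(G)=\bigcup_t V_t$; for each $vw\in E(G)$ there is $t$ with $v,w\in V_t$; and if $v\in V_{t_1}\cap V_{t_2}$ then $v\in V_t$ for every $t$ on the path connecting $t_1$ and $t_2$ in $T$. It has width $k$ if each bag has size at most $k+1$. The tree-width of $G$ is the smallest $k$ for which there is a width $k$ tree decomposition of $G$; the path-width is the same minimum restricted to tree decompositions in which $T$ is a path. *)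

(* Defs.v *)
From mathcomp Require Import all_boot.
From mathcomp Require Import boolp classical_sets functions cardinality.

Set Implicit Arguments.
Unset Strict Implicit.
Unset Printing Implicit Defensive.

Record sgraph := SGraph {
  vertex :> finType;
  adj : rel vertex;
  adj_sym : symmetric adj;
  adj_irr : irreflexive adj }.

Definition edges (G : sgraph) : {set {set G}} :=
  [set [set p.1; p.2] | p : G * G & adj p.1 p.2]%SET.

Definition max_degree (G : sgraph) : nat :=
  \max_(v : G) #|[set w : G | adj v w]%SET|.

(* A list assignment and a colouring are total functions on {set G}, of which
   only the values on [edges G] matter.  Lists may be infinite. *)
Definition edge_colouring (G : sgraph) (L : {set G} -> set nat)
    (C : {set G} -> nat) : Prop :=
  (forall a : {set G}, a \in edges G -> L a (C a)) /\
  (forall a b : {set G}, a \in edges G -> b \in edges G ->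
     a != b -> a :&: b != finset.set0 -> C a != C b).

(* [`I_k #<= L a] is |L a| >= k. *)
Definition edge_choosable (G : sgraph) (k : nat) : Prop :=
  forall L : {set G} -> set nat,
    (forall a : {set G}, a \in edges G -> (`I_k #<= L a)%card) ->
    exists C : {set G} -> nat, edge_colouring L C.

Definition is_tree (T : sgraph) : Prop :=
  [/\ 0 < #|T|,
      forall x y : T, connect (@adj T) x y &
      forall c : seq T, ucycle (@adj T) c -> size c < 3].

Definition is_path (T : sgraph) : Prop :=
  0 < #|T| /\ exists s : seq T,
    [/\ uniq s, s =i T &
        forall x y : T, adj x y =
          ((index x s).+1 == index y s) || ((index y s).+1 == index x s)].

Definition tree_decomposition (G T : sgraph) (B : T -> {set G}) : Prop :=
  [/\ is_tree T,
      forall v : G, exists t : T, v \in B t,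
      forall v w : G, adj v w -> exists t : T, (v \in B t) && (w \in B t) &
      forall (v : G) (t1 : T) (p : seq T),
        path (@adj T) t1 p -> uniq (t1 :: p) ->
        v \in B t1 -> v \in B (last t1 p) ->
        forall t : T, t \in t1 :: p -> v \in B t].

(* Width k means bags of size at most k + 1, so it is upward closed in k. *)
Definition has_width (G T : sgraph) (B : T -> {set G}) (k : nat) : Prop :=
  forall t : T, #|B t| <= k.+1.

Definition has_tree_decomposition (G : sgraph) (k : nat) : Prop :=
  exists (T : sgraph) (B : T -> {set G}),
    tree_decomposition B /\ has_width B k.

Definition has_path_decomposition (G : sgraph) (k : nat) : Prop :=
  exists (T : sgraph) (B : T -> {set G}),
    [/\ tree_decomposition B, is_path T & has_width B k].

Lemma injective_choice (T : eqType) (n : nat) (L : T -> set nat) (s : seq T) :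
  uniq s -> size s <= n -> (forall a, a \in s -> (`I_n #<= L a)%card) ->
  exists C : T -> nat,
    (forall a, a \in s -> L a (C a)) /\ {in s &, injective C}.
Proof.
elim: s => [|a s IHs] /=; first by move=> _ _ _; exists (fun=> 0).
case/andP=> aNs us sn HL.
have [|C [CL Cinj]] := IHs us (ltnW sn).
  by move=> b bs; apply: HL; rewrite inE bs orbT.
have [c Lc cNs] : exists2 c, L a c & c \notin map C s.
  apply: contrapT => noc.
  have /pcard_leP[f] := HL a (mem_head _ _).
  have uf : uniq (map f (iota 0 n)).
    rewrite map_inj_in_uniq ?iota_uniq // => i j.
    rewrite !mem_iota => hi hj; apply: (@inj _ _ _ f); exact: mem_set.
  have sf : {subset map f (iota 0 n) <= map C s}.
    move=> y /mapP[i]; rewrite mem_iota => hi ->; apply: contrapT => /negP fN.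
    by apply: noc; exists (f i) => //; apply: funS.
  by have := uniq_leq_size uf sf; rewrite !size_map size_iota leqNgt sn.
exists (fun b => if b == a then c else C b); split.
  by move=> b; rewrite inE; case: eqP => [-> //|_ /=]; apply: CL.
have CN z : z \in s -> c <> C z by move=> zs e; rewrite e map_f in cNs.
move=> x y; rewrite !inE.
case: eqP => [->|_] /=; case: eqP => [->|_] //= xs ys.
- by move/(CN _ ys).
- by move/esym/(CN _ xs).
exact: Cinj.
Qed.

Lemma edge_choosable_ex (G : sgraph) :
  exists k, `[< edge_choosable G k >].
Proof.
exists #|edges G|; apply/asboolP => L HL.
have [|||C [CL Cinj]] := @injective_choice _ #|edges G| L (enum (edges G)).
- exact: enum_uniq.
- by rewrite cardE.
- by move=> a; rewrite mem_enum; apply: HL.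
exists C; split=> [a aG|a b aG bG ab _]; first by apply: CL; rewrite mem_enum.
by apply: contra ab => /eqP e; apply/eqP/Cinj; rewrite ?mem_enum.
Qed.

(* [ex_minn] is the least k with the stated property; [edge_choosable_ex] only
   certifies that one exists. *)
Definition list_chromatic_index (G : sgraph) : nat :=
  ex_minn (edge_choosable_ex G).

Definition point_graph : sgraph :=
  @SGraph unit (fun _ _ => false) (fun _ _ => erefl) (fun _ => erefl).

Lemma path_decomposition_ex (G : sgraph) :
  exists k, `[< has_path_decomposition G k >].
Proof.
exists #|G|; apply/asboolP; exists point_graph, (fun=> finset.setT).
split; last by move=> t; apply: leq_trans (max_card _) (leqnSn _).
- split.
  + split; [by rewrite card_unit | by case; case; apply: connect0 |].
    by case=> [|x [|y c]] //=; rewrite /ucycle /=; case/andP.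
  + by move=> v; exists tt; rewrite finset.in_setT.
  + by move=> v w _; exists tt; rewrite !finset.in_setT.
  + by move=> *; rewrite finset.in_setT.
- split; first by rewrite card_unit.
  by exists [:: tt]; split=> //; case => //; case.
Qed.

Lemma tree_decomposition_ex (G : sgraph) :
  exists k, `[< has_tree_decomposition G k >].
Proof.
have [k /asboolP[T [B [dB _ wB]]]] := path_decomposition_ex G.
by exists k; apply/asboolP; exists T, B.
Qed.

Definition treewidth (G : sgraph) : nat := ex_minn (tree_decomposition_ex G).

Definition pathwidth (G : sgraph) : nat := ex_minn (path_decomposition_ex G).

(* Main.v *)
(* Let F be a minimal set of edges that cannot be coloured from lists of size
   D.  Every edge uw of F has deg u + deg w >= D + 2, as otherwise it could be
   coloured last, so vertices of degree at most k ("small"), where k is the bound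
   on the width, are pairwise nonadjacent.  Let v be a big vertex whose bags are "deepest" in the
   decomposition: then every neighbour y of v outside some bag is small and all
   its neighbours lie in that bag.  On a path, such vertices y occupy a place in
   an earlier bag, so their neighbours even lie in a set of only k vertices.
   Hence v has at least deg v - k neighbours y of degree between D - deg v + 2
   and k, all attached to v and at most three further vertices x.

   Now delete all edges at some of these y and colour the rest.  The edge vy
   keeps as many colours as there are deleted edges at v, plus D - deg v, and the
   edge xy as many as there are deleted edges at x.  Except for two wheels, some
   of the y always form a configuration to which Galvin's theorem applies.  The
   two wheels arise for D = 7 and D = 6; there edges vx are deleted as well. *)
Require Import Defs.
From mathcomp Require Import boolp classical_sets functions cardinality.
From mathcomp Require Import all_boot zify.

Set Implicit Arguments.
Unset Strict Implicit.
Unset Printing Implicit Defensive.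

(** * Galvin's theorem *)

Definition is_kernel (E : finType) (arc : rel E) (S K : {set E}) :=
  [/\ K \subset S, {in K &, forall a b, ~~ arc a b} &
      {in S :\: K, forall a, exists2 b, b \in K & arc a b}].

(* Bondy, Boppana and Siegel: colour a kernel of the vertices that still have
   the colour [c] by [c]; every other such vertex loses an out-neighbour
   together with [c]. *)
Lemma kernel_colouring (E : finType) (arc : rel E) (H : {set E})
    (L : E -> seq nat) :
  (forall S : {set E}, S \subset H -> exists K, is_kernel arc S K) ->
  {in H, forall a, uniq (L a) /\ #|[set b in H | arc a b]| < size (L a)} ->
  exists C : E -> nat, {in H, forall a, C a \in L a} /\
    {in H &, forall a b, arc a b -> C a != C b}.
Proof.
have [n] := ubnP #|H|; elim: n H L => // n IHn H L leHn kerH HL.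
have [-> | [a0 a0H]] := set_0Vmem H.
  by exists (fun=> 0); split=> a; rewrite inE.
have [c cL] : exists c, c \in L a0.
  have [_] := HL _ a0H; case: (L a0) => // c s _.
  by exists c; rewrite mem_head.
pose S := [set a in H | c \in L a].
have SH : S \subset H by apply/subsetP => a; rewrite inE => /andP[].
have [K [KS indK absK]] := kerH S SH.
have a0S : a0 \in S by rewrite inE a0H.
have [k kK] : exists k, k \in K.
  have [|a0K] := boolP (a0 \in K); first by exists a0.
  by have [|b bK _] := absK a0; [rewrite inE a0K | exists b].
have KH := subset_trans KS SH.
have ltH : #|H :\: K| < n.
  rewrite -ltnS; apply: leq_trans leHn; rewrite ltnS; apply: proper_card.
  rewrite properE subsetDl; apply/subsetPn; exists k; first exact: (subsetP KH).
  by rewrite inE kK.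
have [||C [CL Cadj]] := IHn (H :\: K) (fun a => filter (predC1 c) (L a)) ltH.
- by move=> S' S'H; apply: kerH; apply: subset_trans S'H (subsetDl _ _).
- move=> a; rewrite inE => /andP[aK aH]; have [uL ltL] := HL a aH.
  split; first exact: filter_uniq.
  have [cLa | cLa] := boolP (c \in L a).
    rewrite -rem_filter // size_rem //.
    have [|b bK ab] := absK a; first by rewrite inE aK inE aH.
    rewrite -ltnS prednK; last by apply: leq_ltn_trans ltL.
    apply: leq_trans ltL; rewrite ltnS; apply: proper_card.
    rewrite properE; apply/andP; split.
      by apply/subsetP => x; rewrite !inE => /andP[/andP[_ ->] ->].
    apply/subsetPn; exists b; first by rewrite inE ab (subsetP KH).
    by rewrite !inE bK.
  have -> : filter (predC1 c) (L a) = L a.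
    by apply/all_filterP/allP => x xL /=; apply: contraNneq cLa => <-.
  apply: leq_ltn_trans ltL; apply: subset_leq_card.
  by apply/subsetP => x; rewrite !inE => /andP[/andP[_ ->] ->].
have CNc a : a \in H -> a \notin K -> C a != c.
  by move=> aH aK; have := CL a; rewrite inE aH aK mem_filter => /(_ isT)/andP[].
exists (fun a => if a \in K then c else C a); split=> [a aH|a b aH bH ab].
  case: ifPn => aK; first by have := subsetP KS a aK; rewrite inE => /andP[].
  by have := CL a; rewrite inE aK aH mem_filter => /(_ isT)/andP[].
case: ifPn => aK; case: ifPn => bK.
- by rewrite (negPf (indK a b aK bK)) in ab.
- by rewrite eq_sym CNc.
- exact: CNc.
- by apply: Cadj => //; rewrite inE ?aK ?bK.
Qed.

(* The arcs of Galvin's theorem: [p] and [q] are the two ends of an edge, and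
   larger labels are preferred at [p], smaller ones at [q]. *)
Definition galvin_arc (E : Type) (p q lab : E -> nat) (a b : E) :=
  (p a == p b) && (lab a < lab b) || (q a == q b) && (lab b < lab a).

(* Stable matchings, after Maffray: if two edges that are best at their
   [p]-ends meet in a [q]-end, then the less preferred one is redundant. *)
Lemma galvin_kernel (E : finType) (p q lab : E -> nat) (S : {set E}) :
  exists K, is_kernel (galvin_arc p q lab) S K.
Proof.
have [n] := ubnP #|S|; elim: n S => // n IHn S leSn.
pose best a := [forall x in S, (p x == p a) ==> (lab x <= lab a)].
have bestP a x : best a -> x \in S -> p x = p a -> lab x <= lab a.
  by move=> /forall_inP/(_ x) + xS pxa => /(_ xS)/implyP; rewrite pxa eqxx; apply.
have [/existsP[a /existsP[a' /and5P[aS a'S ba ba']]] | noa] :=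
  boolP [exists a, exists a', [&& a \in S, a' \in S, best a, best a' &
                               (q a == q a') && (lab a' < lab a)]].
  move=> /andP[/eqP qa lta].
  (* [a] is the redundant edge: a kernel of the rest absorbs it through [a'], or through the edge
     that absorbs [a']. *)
  have [|K [KS indK absK]] := IHn (S :\ a).
    by rewrite -ltnS; apply: leq_trans leSn; rewrite [#|S|](cardsD1 a) aS.
  exists K; split=> //; first exact: subset_trans KS (subsetDl _ _).
  move=> x; rewrite inE => /andP[xK xS].
  have [exa | xa] := eqVneq x a; last by apply: absK; rewrite !inE xK xa.
  rewrite {}exa {xK xS} => {x}.
  have [a'K | a'K] := boolP (a' \in K).
    by exists a' => //; rewrite /galvin_arc qa eqxx lta orbT.
  have [|f fK] := absK a'.
    by rewrite !inE a'K a'S andbT; apply: contraTneq lta => ->; rewrite ltnn.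
  (* No arc leaves [a'] at its [p]-end, where it is best; so [f] meets it in the [q]-end, and
     transitivity gives an arc from [a]. *)
  case/orP=> /andP[/eqP e ltf]; last first.
    by exists f => //; rewrite /galvin_arc qa e eqxx (ltn_trans ltf lta) orbT.
  have fS : f \in S by have := subsetP KS f fK; rewrite inE => /andP[].
  by have := bestP _ _ ba' fS (esym e); rewrite leqNgt ltf.
exists [set a in S | best a]; split.
- by apply/subsetP => a; rewrite inE => /andP[].
- move=> a b; rewrite !inE => /andP[aS ba] /andP[bS bb].
  apply: contra noa => /orP[] /andP[/eqP e lt].
    by have := bestP _ _ ba bS (esym e); rewrite leqNgt lt.
  apply/existsP; exists a; apply/existsP; exists b.
  by rewrite aS bS ba bb e eqxx.
move=> a; rewrite !inE => /andP[]; case: (boolP (a \in S)) => //= aS nba _.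
have Pa : (a \in S) && (p a == p a) by rewrite aS eqxx.
have [b] := arg_maxnP (P := fun x => (x \in S) && (p x == p a)) lab Pa.
move=> /andP[bS /eqP pb] maxb.
have bb : best b.
  apply/forall_inP => x xS; apply/implyP => /eqP px; apply: maxb.
  by rewrite xS px pb eqxx.
exists b; first by rewrite inE bS.
rewrite /galvin_arc pb eqxx /= ltnNge.
apply/orP; left; apply: contra nba => leb.
apply/forall_inP => x xS; apply/implyP => /eqP px.
by apply: leq_trans leb; apply: bestP => //; rewrite pb.
Qed.

(* Small concrete graphs are lists [ps] of pairs of vertex numbers, and [f e] is
   the size of the list of [e]. *)
Definition share (e e' : nat * nat) :=
  [|| e.1 == e'.1, e.1 == e'.2, e.2 == e'.1 | e.2 == e'.2].

Definition colourable (ps : seq (nat * nat)) (L : nat * nat -> seq nat) :=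
  exists C : nat * nat -> nat, {in ps, forall e, C e \in L e} /\
    {in ps &, forall e e', e != e' -> share e e' -> C e != C e'}.

Definition choosable (ps : seq (nat * nat)) (f : nat * nat -> nat) :=
  forall L : nat * nat -> seq nat,
    {in ps, forall e, uniq (L e) /\ f e <= size (L e)} -> colourable ps L.

(** Boolean, so that concrete instances are decided by computation; only the existence of kernels is
    left to proof. *)
Definition oriented (arc : rel (nat * nat)) (ps : seq (nat * nat))
    (f : nat * nat -> nat) :=
  all (fun e => count (arc e) ps < f e) ps &&
  all (fun e => all (fun e' =>
    (share e e' && (e != e')) ==> (arc e e' || arc e' e)) ps) ps.

Lemma oriented_choosable arc ps f : oriented arc ps f ->
  (forall S : {set seq_sub ps},
     exists K, is_kernel (fun a b => arc (val a) (val b)) S K) ->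
  choosable ps f.
Proof.
move=> /andP[/allP outf /allP adjf] kerS L HL.
have [|a _|C [CL Cadj]] := @kernel_colouring (seq_sub ps)
  (fun a b => arc (val a) (val b)) setT (fun a => L (val a)).
- by move=> S _; apply: kerS.
- have [uL leL] := HL _ (valP a); split=> //.
  apply: leq_trans leL; apply: leq_ltn_trans (outf _ (valP a)).
  rewrite cardE -(size_map val) -size_filter; apply: uniq_leq_size.
    by rewrite (map_inj_uniq val_inj) enum_uniq.
  move=> e /mapP[b]; rewrite mem_enum !inE /= => ab ->.
  by rewrite mem_filter ab (valP b).
have [ps0 | [e0 e0ps]] : ps = [::] \/ exists e0, e0 \in ps.
- by case: (ps) => [|e0 s]; [left | right; exists e0; rewrite mem_head].
- by rewrite ps0; exists (fun=> 0); split=> [e|e e']; rewrite in_nil.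
pose s e : seq_sub ps := insubd (SeqSub e0ps) e.
have sK e : e \in ps -> val (s e) = e by move=> eps; rewrite val_insubd eps.
exists (fun e => C (s e)); split=> [e eps|e e' eps e'ps nee' she].
  by rewrite -{2}(sK e eps); apply: CL; rewrite inE.
have := implyP (allP (adjf e eps) e' e'ps); rewrite she nee' => /(_ isT)/orP[] ar.
  by apply: Cadj; rewrite ?inE // !sK.
by rewrite eq_sym; apply: Cadj; rewrite ?inE // !sK.
Qed.

Lemma galvin_choosable lab ps f :
  oriented (galvin_arc snd fst lab) ps f -> choosable ps f.
Proof.
move=> /oriented_choosable; apply => S.
exact: (galvin_kernel (fun a : seq_sub ps => (val a).2)
  (fun a => (val a).1) (fun a => lab (val a)) S).
Qed.

(** * Colouring some edges first *)

Lemma shareC e e' : share e e' = share e' e.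
Proof.
rewrite /share [e.1 == e'.1]eq_sym [e.1 == e'.2]eq_sym [e.2 == e'.1]eq_sym.
by rewrite [e.2 == e'.2]eq_sym; congr (_ || _); rewrite orbCA.
Qed.

(** All of [Q] gets colour [c]. An edge meeting [Q] loses at most [c], and an edge of [N] loses
    nothing because [c] is not in its list. *)
Lemma colour_class (ps : seq (nat * nat)) (f : nat * nat -> nat)
    (L : nat * nat -> seq nat) (Q N : seq (nat * nat)) c :
  {in Q, forall e, c \in L e} ->
  {in Q &, forall e e', e != e' -> ~~ share e e'} ->
  {in N, forall e, c \notin L e} ->
  {in ps, forall e, uniq (L e) /\ f e <= size (L e)} ->
  choosable [seq e <- ps | e \notin Q]
    (fun e => f e - ((e \notin N) && has (share e) Q)) ->
  colourable ps L.
Proof.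
move=> QL Qind NL Lf.
pose L' e := if has (share e) Q then filter (predC1 c) (L e) else L e.
move=> /(_ L')[e | C [CL Cadj]].
  rewrite mem_filter /L' => /andP[_ /Lf[uL leL]].
  case: ifP => _; last by rewrite andbF subn0.
  split; first exact: filter_uniq.
  rewrite -rem_filter //; have [cL | cL] := boolP (c \in L e).
    rewrite size_rem // andbT leq_subLR; apply: leq_trans leL _.
    rewrite -(prednK (n := size _)) ?leq_add2r; last by case: (L e) cL.
    suff -> : e \notin N by [].
    by apply: contraL cL; apply: NL.
  by rewrite rem_id // (leq_trans (leq_subr _ _)).
have CLe e : e \in ps -> e \notin Q ->
    (C e \in L e) /\ (has (share e) Q -> C e != c).
  move=> eps eQ; have := CL e; rewrite mem_filter eQ eps /L' => /(_ isT).
  by case: ifP => _ //; rewrite mem_filter => /andP[].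
have CQ e e' : e \in ps -> e \notin Q -> e' \in Q -> share e e' -> C e != c.
  by move=> eps eQ e'Q she; apply: (CLe e eps eQ).2; apply/hasP; exists e'.
exists (fun e => if e \in Q then c else C e); split=> [e eps | e e' eps e'ps].
  by case: ifPn => eQ; [apply: QL | apply: (CLe e eps eQ).1].
move=> nee' she; case: ifPn => eQ; case: ifPn => e'Q.
- by have := Qind e e' eQ e'Q nee'; rewrite she.
- by rewrite eq_sym; apply: (CQ e' e); rewrite // shareC.
- exact: (CQ e e').
- by apply: Cadj; rewrite ?mem_filter ?eQ ?e'Q.
Qed.

(** The edges of [es] are coloured one by one, then Galvin's theorem must finish. The form with
    [[:: e]] matches [colour_class] for [Q = [:: e]]. *)
Fixpoint greedy_galvin (es : seq (nat * nat)) (lab : nat * nat -> nat)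
    (ps : seq (nat * nat)) (f : nat * nat -> nat) : bool :=
  if es is e :: es' then
    [&& e \in ps, 0 < f e & greedy_galvin es' lab
      [seq e' <- ps | e' \notin [:: e]] (fun e' => f e' - has (share e') [:: e])]
  else oriented (galvin_arc snd fst lab) ps f.

Lemma greedy_galvin_choosable es lab ps f :
  greedy_galvin es lab ps f -> choosable ps f.
Proof.
elim: es ps f => [|e es IHes] ps f /=; first exact: galvin_choosable.
move=> /and3P[eps fe /IHes Hes] L Lf.
have [_ leL] := Lf e eps; have [c cL] : exists c, c \in L e.
  by case: (L e) (leq_trans fe leL) => // c s _; exists c; rewrite mem_head.
apply: (@colour_class ps f L [:: e] [::] c) => //.
- by move=> e'; rewrite inE => /eqP->.
- by move=> e1 e2; rewrite !inE => /eqP-> /eqP->; rewrite eqxx.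
Qed.

(** Exact sizes allow [wheel4] to write out its short lists and give [wheel6] an upper bound on a
    long one. *)
Lemma choosable_trim ps f :
  (forall L : nat * nat -> seq nat,
    {in ps, forall e, uniq (L e) /\ size (L e) = f e} -> colourable ps L) ->
  choosable ps f.
Proof.
move=> Hps L Lf; have [|C [CL Cadj]] := Hps (fun e => take (f e) (L e)).
  move=> e /Lf[uL leL]; rewrite take_uniq //; split=> //.
  by rewrite size_take_min; apply/minn_idPl.
by exists C; split=> // e /CL/mem_take.
Qed.

Definition assoc (t : seq (nat * nat * nat)) (e : nat * nat) : nat :=
  nth 0 (unzip2 t) (index e (unzip1 t)).

(** * The two wheels *)

(* The wheel with hub 0 and rim 3 1 4 2; vertices 1 and 2 play the role of the x,
   vertices 3 and 4 that of the y. *)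
Definition wheel4 : seq (nat * nat) :=
  [:: (0, 1); (0, 2); (0, 3); (0, 4); (1, 3); (1, 4); (2, 3); (2, 4)].

Definition wheel4_size (e : nat * nat) :=
  if e.1 == 0 then (if e.2 < 3 then 2 else 5) else 3.

(* The situation after the edges of [Q] have received a common colour that is
   missing in the lists of the edges in [N]. *)
Definition class_check ps f (Q N : seq (nat * nat)) es lab :=
  greedy_galvin es lab [seq e <- ps | e \notin Q]
    (fun e => f e - ((e \notin N) && has (share e) Q)).

Lemma class_checkP ps f (Q N : seq (nat * nat)) es lab L c :
  class_check ps f Q N es lab ->
  {in Q, forall e, c \in L e} ->
  {in Q &, forall e e', e != e' -> ~~ share e e'} ->
  {in N, forall e, c \notin L e} ->
  {in ps, forall e, uniq (L e) /\ f e <= size (L e)} -> colourable ps L.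
Proof.
move=> /greedy_galvin_choosable ch QL Qind NL Lf.
exact: (colour_class QL Qind NL Lf ch).
Qed.

(** A colour common to two nonadjacent edges could be given to both; by the check, the rest could
    then be coloured. *)
Lemma class_check_common ps f e e' es lab L :
  class_check ps f [:: e; e'] [::] es lab -> ~~ share e e' ->
  {in ps, forall e, uniq (L e) /\ f e <= size (L e)} ->
  ~ colourable ps L -> forall c, c \in L e -> c \in L e' -> False.
Proof.
move=> ck nsh Lf ncol c ce ce'; apply: ncol.
apply: (@class_checkP _ _ _ _ _ _ _ c ck _ _ _ Lf).
- by move=> x; rewrite !inE => /orP[] /eqP-> .
- move=> x y; rewrite !inE => /orP[] /eqP-> /orP[] /eqP-> //; rewrite ?eqxx //.
  by rewrite shareC.
- by [].
Qed.

(** A colour of [e] outside [L e'] could be given to [e] at no cost to [e']; by the check, this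
    saving makes the rest colourable. *)
Lemma class_check_sub ps f e e' es lab L :
  class_check ps f [:: e] [:: e'] es lab ->
  {in ps, forall e, uniq (L e) /\ f e <= size (L e)} ->
  ~ colourable ps L -> {subset L e <= L e'}.
Proof.
move=> ck Lf ncol c ce; apply: contraT => ce'; case: ncol.
apply: (@class_checkP _ _ _ _ _ _ _ c ck _ _ _ Lf).
- by move=> x; rewrite !inE => /eqP-> .
- by move=> x y; rewrite !inE => /eqP-> /eqP->; rewrite eqxx.
- by move=> x; rewrite !inE => /eqP-> .
Qed.

(** A symmetry of the wheel without the spokes at 1 and 2; it lets one label table serve all [i] and
    [j]. *)
Definition relabel4 i j (e : nat * nat) : nat * nat :=
  (if e.1 == 0 then 0 else if e.1 == i then 1 else 2,
   if e.2 == j then 3 else 4).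

Lemma wheel4_choosable : choosable wheel4 wheel4_size.
Proof.
apply: choosable_trim => L Lsz.
have Lf : {in wheel4, forall e, uniq (L e) /\ wheel4_size e <= size (L e)}.
  by move=> e /Lsz[? ->].
case: (boolp.pselect (colourable wheel4 L)) => // ncol; exfalso.
(* Each spoke [(0, i)] shares no colour with the rim edges that it does not meet,
   and its list is contained in the other lists at [i] and in those of the two
   long spokes; this leaves only one colouring to write down. *)
pose es1 i j : seq (nat * nat) :=
  [:: (0, 3 - i); (3 - i, 7 - j); (i, 7 - j); (i, j); (0, 7 - j); (0, j)].
(* Once [(0, i)] and [(3 - i, j)] share a colour, the other six edges are coloured greedily in the
   order [es1 i j]. *)
have far i j : i \in [:: 1; 2] -> j \in [:: 3; 4] ->
    forall c, c \in L (0, i) -> c \in L (3 - i, j) -> False.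
  move=> iI jJ.
  apply: (@class_check_common _ wheel4_size _ _ (es1 i j) (fun=> 0) L _ _ Lf ncol);
    by move: iI jJ; rewrite !inE => /orP[]/eqP-> /orP[]/eqP->.
pose lab2 e := assoc [:: (0, 3, 2); (0, 4, 1); (1, 3, 3); (1, 4, 4);
  (2, 3, 4); (2, 4, 2)] e.
have hub i j : i \in [:: 1; 2] -> j \in [:: 3; 4] ->
    {subset L (0, i) <= L (0, j)}.
  move=> iI jJ; apply: (@class_check_sub _ wheel4_size _ _ [:: (0, 3 - i)]
    (fun e => lab2 (relabel4 i j e)) L _ Lf ncol).
  by move: iI jJ; rewrite !inE => /orP[]/eqP-> /orP[]/eqP->.
pose lab3 e := assoc [:: (0, 3, 2); (0, 4, 1); (1, 3, 1); (1, 4, 3);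
  (2, 3, 3); (2, 4, 2)] e.
have near i j : i \in [:: 1; 2] -> j \in [:: 3; 4] ->
    {subset L (0, i) <= L (i, j)}.
  move=> iI jJ; apply: (@class_check_sub _ wheel4_size _ _ [:: (0, 3 - i)]
    (fun e => lab3 (relabel4 i j e)) L _ Lf ncol).
  by move: iI jJ; rewrite !inE => /orP[]/eqP-> /orP[]/eqP->.
have [ub1 sb1] := Lsz (0, 1) isT; have [ub2 sb2] := Lsz (0, 2) isT.
have surplus i j (iI : i \in [:: 1; 2]) (jJ : j \in [:: 3; 4]) :
    exists2 c, c \in L (i, j) & c \notin L (0, i).
  have [|uL sL] := Lsz (i, j).
    by move: iI jJ; rewrite !inE => /orP[]/eqP-> /orP[]/eqP->.
  apply/hasP; rewrite has_predC; apply/allP => sub.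
  have := uniq_leq_size uL sub; rewrite sL.
  by move: iI; rewrite !inE => /orP[]/eqP->; rewrite ?sb1 ?sb2.
have [s1 s1L s1b] := surplus 1 3 isT isT.
have [s2 s2L s2b] := surplus 2 4 isT isT.
move: ub1 sb1 ub2 sb2 s1b s2b (far 1 3 isT isT) (far 1 4 isT isT)
  (fun h => far 2 3 isT isT s1 h s1L) (far 2 4 isT isT)
  (hub 1 3 isT isT) (hub 2 4 isT isT)
  (near 1 4 isT isT) (near 2 3 isT isT).
case L1: (L (0, 1)) => [|b [|b' []]] //; case L2: (L (0, 2)) => [|d [|d' []]] //=.
rewrite !inE !andbT !negb_or => bb' _ dd' _ /andP[s1b s1b'] /andP[s2d s2d'].
move=> b_far b_far2 s1_far d_far2 b_hub d_hub b_near d_near.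
have bI : b \in [:: b; b'] by rewrite mem_head.
have b'I : b' \in [:: b; b'] by rewrite !inE eqxx orbT.
have dI : d \in [:: d; d'] by rewrite mem_head.
have d'I : d' \in [:: d; d'] by rewrite !inE eqxx orbT.
(* [L (0, 2)] is contained in [L (2, 3)], which has no colour in common with [L (0, 1)]. *)
have bd x y : x \in [:: b; b'] -> y \in [:: d; d'] -> x != y.
  move=> xI yI; apply/eqP => exy; apply: (b_far x xI); apply: d_near.
  by rewrite exy.
have s1d' : s1 != d'.
  by apply/eqP => e; apply: s1_far => //; rewrite e eqxx orbT.
have s2b : s2 != b by apply/eqP => e; apply: (b_far2 b) => //; rewrite -e.
(* [b] and [d'] are used twice, each on a long spoke and on a rim edge that does not meet it. *)
pose t := [:: (0, 1, b'); (0, 2, d); (0, 3, b); (0, 4, d'); (1, 3, s1);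
  (1, 4, b); (2, 3, d'); (2, 4, s2)].
apply: ncol; exists (assoc t); split.
  apply/allP; rewrite /assoc /= L1 L2 b'I dI s1L s2L.
  by rewrite b_hub ?d_hub ?b_near ?d_near.
have neq (x y : nat) : x != y -> (x == y = false) * (y == x = false).
  by move=> xy; rewrite [y == x]eq_sym (negPf xy).
have nE := (neq _ _ bb', neq _ _ dd', neq _ _ s1b, neq _ _ s1b', neq _ _ s2d,
  neq _ _ s2d', neq _ _ s1d', neq _ _ s2b, neq _ _ (bd b d bI dI),
  neq _ _ (bd b d' bI d'I), neq _ _ (bd b' d b'I dI), neq _ _ (bd b' d' b'I d'I)).
suff: all (fun e => all (fun e' =>
    (e != e') && share e e' ==> (assoc t e != assoc t e')) wheel4) wheel4.
  move=> /allP tP e e' /tP /allP tPe /tPe /implyP tee' nee' she.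
  by apply: tee'; rewrite nee'.
by rewrite /assoc /= !nE.
Qed.

(* The wheel with hub 0, where 1, 2, 3 are the x and 4, 5, 6 the y; the vertex
   3 + i is opposite to i on the rim. *)
Definition wheel6 : seq (nat * nat) :=
  [:: (0, 1); (0, 2); (0, 3); (0, 4); (0, 5); (0, 6);
      (1, 5); (1, 6); (2, 4); (2, 6); (3, 4); (3, 5)].

Definition wheel6_size (e : nat * nat) :=
  if (e.1 == 0) && (3 < e.2) then 7 else 3.

(** Permutes the x and moves each y with the opposite x; applied once the spokes at 1, 2, 3 are
    gone. *)
Definition relabel6 i j (e : nat * nat) : nat * nat :=
  let r m := if m == i then 1 else if m == j then 2 else 3 in
  (if e.1 == 0 then 0 else r e.1, 3 + r (e.2 - 3)).

Lemma wheel6_choosable : choosable wheel6 wheel6_size.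
Proof.
apply: choosable_trim => L Lsz.
have Lf : {in wheel6, forall e, uniq (L e) /\ wheel6_size e <= size (L e)}.
  by move=> e /Lsz[? ->].
case: (boolp.pselect (colourable wheel6 L)) => // ncol; exfalso.
(* As for [wheel4]; but now the three lists of size 3 at [(0, i)], [i <= 3],
   become disjoint subsets of a list of size 7. *)
pose I := [:: 1; 2; 3].
have far i j : i \in I -> j \in I -> i != j ->
    forall c, c \in L (0, i) -> c \in L (j, 3 + (6 - i - j)) -> False.
  (* [k] is the third index, as 1 + 2 + 3 = 6; [es] lists the ten remaining edges for a greedy
     colouring. *)
  pose k := 6 - i - j; pose es : seq (nat * nat) := [:: (0, j); (0, k);
    (j, 3 + i); (k, 3 + i); (k, 3 + j); (i, 3 + j); (i, 3 + k);
    (0, 3 + i); (0, 3 + j); (0, 3 + k)].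
  move=> iI jI ij.
  apply: (@class_check_common _ wheel6_size _ _ es (fun=> 0) L _ _ Lf ncol);
    by move: iI jI ij; rewrite /es /k !inE => /or3P[]/eqP-> /or3P[]/eqP->.
pose lab2 e := assoc [:: (0, 4, 3); (0, 5, 1); (0, 6, 2); (1, 5, 2); (1, 6, 4);
  (2, 4, 5); (2, 6, 3); (3, 4, 4); (3, 5, 5)] e.
have hub i j : i \in I -> j \in I -> {subset L (0, i) <= L (0, 3 + j)}.
  move=> iI jJ; apply: (@class_check_sub _ wheel6_size _ _
    [seq (0, m) | m <- I & m != i]
    (fun e => lab2 (relabel6 j (j %% 3).+1 e)) L _ Lf ncol).
  by move: iI jJ; rewrite !inE => /or3P[]/eqP-> /or3P[]/eqP->.
pose lab3 e := assoc [:: (0, 4, 1); (0, 5, 3); (0, 6, 2); (1, 5, 1); (1, 6, 4);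
  (2, 4, 4); (2, 6, 3); (3, 4, 2); (3, 5, 4)] e.
have near i j : i \in I -> j \in I -> i != j -> {subset L (0, i) <= L (i, 3 + j)}.
  move=> iI jI ij; apply: (@class_check_sub _ wheel6_size _ _
    [seq (0, m) | m <- I & m != i]
    (fun e => lab3 (relabel6 i j e)) L _ Lf ncol).
  by move: iI jI ij; rewrite !inE => /or3P[]/eqP-> /or3P[]/eqP->.
have disj i j : i \in I -> j \in I -> i != j -> ~~ has (mem (L (0, i))) (L (0, j)).
  move=> iI jI ij; apply/hasPn => c cj; apply/negP => ci.
  apply: (far i j iI jI ij c ci); apply: (near j (6 - i - j)) => //;
    by move: iI jI ij {cj ci}; rewrite !inE => /or3P[]/eqP-> /or3P[]/eqP->.
have [u1 s1] := Lsz (0, 1) isT; have [u2 s2] := Lsz (0, 2) isT.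
have [u3 s3] := Lsz (0, 3) isT; have [u4 s4] := Lsz (0, 4) isT.
suff : size (L (0, 1) ++ L (0, 2) ++ L (0, 3)) <= size (L (0, 4)).
  by rewrite !size_cat s1 s2 s3 s4.
apply: uniq_leq_size.
  rewrite !cat_uniq u1 u2 u3 has_cat negb_or.
  by rewrite (disj 1 2) // (disj 1 3) // (disj 2 3).
move=> c; rewrite !mem_cat.
by case/or3P; [apply: (hub 1 1) | apply: (hub 2 1) | apply: (hub 3 1)].
Qed.

(** * Unavoidable configurations *)

(* Rows of a matrix are the vertices y and columns are v and up to three x; an
   entry 0 is a non-edge, any other entry is the label of the edge in Galvin's
   theorem.  Vertices are numbered 0 for v, 1, 2, 3 for the x and from 4 on for
   the y. *)
Definition entry (M : seq (seq nat)) i z := nth 0 (nth [::] M i) z.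

Definition matrix_edges (M : seq (seq nat)) : seq (nat * nat) :=
  [seq (z, 4 + i) | i <- iota 0 (size M),
                    z <- [seq z <- iota 0 4 | 0 < entry M i z]].

Definition pdeg (ps : seq (nat * nat)) i :=
  count (fun e => (e.1 == i) || (e.2 == i)) ps.

Definition extra j (i : nat) := if i == 0 then j else 0.

Definition pattern (row : seq nat) := [seq 0 < m | m <- behead row].

(* A pair [(j, M)] is a configuration whose edges at v need [j] more colours than
   there are rows.  The matrices were found by a computer search. *)
Definition galvin_table : seq (nat * seq (seq nat)) :=
  [:: (0, [:: [:: 1; 0; 0; 2]; [:: 2; 0; 0; 1]]);
      (0, [:: [:: 1; 0; 2; 3]; [:: 2; 0; 3; 1]; [:: 3; 0; 1; 2]]);
      (0, [:: [:: 2; 0; 0; 3]; [:: 1; 0; 3; 2]; [:: 3; 0; 2; 1]]);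
      (0, [:: [:: 2; 0; 3; 0]; [:: 3; 0; 0; 1]; [:: 1; 0; 2; 3]]);
      (1, [:: [:: 1; 3; 0; 2]; [:: 2; 0; 3; 4]; [:: 3; 0; 4; 1]]);
      (0, [:: [:: 1; 2; 3; 4]; [:: 2; 1; 4; 3]; [:: 3; 4; 1; 2]; [:: 4; 3; 2; 1]]);
      (0, [:: [:: 2; 0; 3; 4]; [:: 1; 2; 4; 3]; [:: 3; 4; 1; 2]; [:: 4; 3; 2; 1]]);
      (0, [:: [:: 2; 3; 0; 4]; [:: 3; 0; 4; 2]; [:: 1; 4; 2; 3]; [:: 4; 2; 3; 1]]);
      (0, [:: [:: 1; 2; 0; 4]; [:: 2; 4; 0; 3]; [:: 3; 0; 4; 1]; [:: 4; 0; 3; 2]]);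
      (0, [:: [:: 1; 2; 3; 0]; [:: 2; 4; 0; 3]; [:: 3; 0; 1; 4]; [:: 4; 0; 2; 1]]);
      (0, [:: [:: 3; 0; 0; 4]; [:: 1; 2; 3; 0]; [:: 2; 4; 0; 3]; [:: 4; 0; 2; 1]]);
      (0, [:: [:: 3; 0; 0; 4]; [:: 1; 2; 4; 0]; [:: 2; 4; 3; 0]; [:: 4; 0; 1; 2]]);
      (0, [:: [:: 3; 0; 4; 0]; [:: 4; 0; 0; 1]; [:: 1; 4; 2; 0]; [:: 2; 3; 0; 4]]);
      (0, [:: [:: 1; 0; 2; 0]; [:: 4; 0; 0; 5]; [:: 2; 3; 5; 4]; [:: 3; 5; 4; 1];
              [:: 5; 4; 1; 2]])].

(** Lists are as large as the degree of the column end, plus the surplus at v: all edges at a row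
    vertex are deleted, so colours are lost only at the column end. *)
Definition table_check (p : nat * seq (seq nat)) :=
  uniq (matrix_edges p.2) && (matrix_edges p.2 != [::]) &&
  oriented (galvin_arc snd fst (fun e => entry p.2 (e.2 - 4) e.1)) (matrix_edges p.2)
      (fun e => pdeg (matrix_edges p.2) e.1 + extra p.1 e.1) &&
  all (fun i => let row := nth [::] p.2 i in
    [&& size row == 4, 0 < head 0 row &
        pdeg (matrix_edges p.2) (4 + i) == (count id (pattern row)).+1])
    (iota 0 (size p.2)).

Lemma galvin_table_checked : all table_check galvin_table.
Proof. by vm_compute. Qed.

Definition permute (s : seq nat) (t : seq bool) := [seq nth false t i | i <- s].

Definition perms3 : seq (seq nat) :=
  [:: [:: 0; 1; 2]; [:: 0; 2; 1]; [:: 1; 0; 2]; [:: 1; 2; 0]; [:: 2; 0; 1];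
      [:: 2; 1; 0]].

(* A vertex y is described by its adjacencies to the three x. *)
Definition contains (ts : seq (seq bool)) (rows : seq (seq bool)) :=
  all (fun r => count_mem r rows <= count_mem r ts) rows.

(** The x carry no fixed order, hence the permutations; a surplus larger than [p.1] does no harm. *)
Definition reducible j (ts : seq (seq bool)) :=
  has (fun p => (p.1 <= j) && has (fun s =>
    contains (map (permute s) ts) (map pattern p.2)) perms3) galvin_table.

(* Every multiset of [n] elements of [ts], together with [s], contains a
   multiset that satisfies [P]. *)
Fixpoint unavoidable (T : Type) (P : pred (seq T)) n (ts s : seq T) : bool :=
  P s || (if n is n'.+1 then
    (fix next ts := if ts is t :: ts' then unavoidable P n' ts (t :: s) && next ts'
                    else true) ts
  else false).

Lemma unavoidableP (T : eqType) (P : pred (seq T)) n (ts t : seq T) :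
  unavoidable P n ts [::] -> n <= size t -> {subset t <= ts} ->
  exists u w, perm_eq (u ++ w) t /\ P u.
Proof.
suff gen s : unavoidable P n ts s -> n <= size t -> {subset t <= ts} ->
    exists u w, perm_eq (u ++ w) t /\ P (catrev u s).
  move=> cov le sub; have [u [w [pt Pu]]] := gen _ cov le sub.
  by exists (rev u), w; rewrite (perm_trans _ pt) // perm_cat2r perm_rev.
elim: n ts s t => [|n IHn] ts s t /=.
  by rewrite orbF => Ps _ _; exists [::], t.
case/orP=> [Ps _ _ | ]; first by exists [::], t.
elim: ts => [|x ts IHts].
  by case: t => // y t _ _ /(_ y (mem_head _ _)).
case/andP=> covx covts szt sub; have [xt | xt] := boolP (x \in t); last first.
  apply: IHts => // y yt; have := sub y yt; rewrite inE => /predU1P[eyx|//].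
  by rewrite -eyx yt in xt.
have [||u [w [pt Pu]]] := IHn _ _ (rem x t) covx.
- by rewrite size_rem // -ltnS prednK //; case: (t) szt.
- by move=> y /mem_rem/sub.
exists (x :: u), w; split=> //=.
by rewrite perm_sym (perm_trans (perm_to_rem xt)) // perm_cons perm_sym.
Qed.

Definition types3 : seq (seq bool) :=
  let bs := [:: true; false] in
  [seq [:: a.1; a.2; b] | a <- [seq (a, b) | a <- bs, b <- bs], b <- bs].

Definition types a b := [seq t <- types3 | a <= count id t <= b].

Definition pairs3 := types 2 2.

(** The 0 in the name is the surplus [j = D - degree F v], and similarly below. A y has between
    [j + 1] and [k - 1] neighbours among the x; the length is the number of y sure to exist, here 7
    - 3. *)
Lemma unavoidable_tree0 : unavoidable (reducible 0) 4 (types 1 2) [::].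
Proof. by vm_compute. Qed.

(** Only one multiset can escape: the three pairs of x, once each. It leads to [wheel6]. *)
Lemma unavoidable_tree1 :
  unavoidable (fun ts => reducible 1 ts || perm_eq ts pairs3)
  3 (types 2 2) [::].
Proof. by vm_compute. Qed.

Lemma unavoidable_tree1' : unavoidable (reducible 1) 4 (types 2 2) [::].
Proof. by vm_compute. Qed.

Definition types_path3 a := [seq t <- types a 2 | ~~ nth false t 2].

Lemma unavoidable_path3_0 : unavoidable (reducible 0) 3 (types_path3 1) [::].
Proof. by vm_compute. Qed.

Lemma unavoidable_path3_1 : unavoidable (reducible 1) 3 (types_path3 2) [::].
Proof. by vm_compute. Qed.

(** For surplus [j] there are at least [10 - j - 4] vertices y, hence the lengths 6, 5 and 4. *)
Lemma unavoidable_path4_0 : unavoidable (reducible 0) 6 (types 1 3) [::].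
Proof. by vm_compute. Qed.

Lemma unavoidable_path4_1 : unavoidable (reducible 1) 5 (types 2 3) [::].
Proof. by vm_compute. Qed.

Lemma unavoidable_path4_2 : unavoidable (reducible 2) 4 (types 3 3) [::].
Proof. by vm_compute. Qed.

(** Turns an inclusion of multisets of types into distinct vertices: each row picks a preimage,
    which is then removed from [ys]. *)
Lemma sub_rows (T A : eqType) (tau : T -> A) (ys : seq T) (rows : seq A) :
  {in rows, forall r, count_mem r rows <= count_mem r (map tau ys)} ->
  exists zs, [/\ map tau zs = rows, {subset zs <= ys} & uniq ys -> uniq zs].
Proof.
elim: rows ys => [|r rows IHrows] ys sub; first by exists [::].
have : r \in map tau ys.
  by rewrite -has_pred1 has_count (leq_trans _ (sub r (mem_head _ _))) //= eqxx.
case/mapP=> y yys er.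
have [r' r'rows | zs [<- subzs uzs]] := IHrows (rem y ys).
  rewrite -(leq_add2l (r == r')) -[X in X <= _]/(count_mem r' (r :: rows)).
  apply: leq_trans (sub r' _) _; first by rewrite inE r'rows orbT.
  by rewrite (permP (perm_map tau (perm_to_rem yys))) /= er.
exists (y :: zs); split=> /= [|z|uys]; first by rewrite er.
  by rewrite inE => /predU1P[-> // | /subzs/mem_rem].
rewrite uzs ?rem_uniq // andbT; apply/negP => /subzs.
by rewrite mem_rem_uniq // !inE eqxx.
Qed.

(** * Deleting edges of a minimal counterexample *)

Section Reduction.

Variable V : finType.
Implicit Types (F H : {set {set V}}) (L : {set V} -> seq nat).

Definition proper_colouring F L (C : {set V} -> nat) :=
  {in F, forall a, C a \in L a} /\
  {in F &, forall a b, a != b -> a :&: b != set0 -> C a != C b}.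

Definition list_colourable F D := forall L,
  {in F, forall a, uniq (L a) /\ D <= size (L a)} ->
  exists C, proper_colouring F L C.

Definition degree F u := #|[set a in F | u \in a]|.

Lemma size_filter_notin (s t : seq nat) :
  uniq s -> size s - size t <= size [seq c <- s | c \notin t].
Proof.
move=> us; rewrite leq_subLR -(count_predC (mem t) s) -!size_filter.
rewrite leq_add2r; apply: uniq_leq_size; first exact: filter_uniq.
by move=> c; rewrite mem_filter => /andP[].
Qed.

Lemma degreeD F H u : H \subset F -> degree (F :\: H) u = degree F u - degree H u.
Proof.
move=> HF; have -> : degree H u = #|[set a in F | u \in a] :&: [set a in H | u \in a]|.
  apply: eq_card => a; rewrite !inE; have [aH | aH] := boolP (a \in H).
    by rewrite (subsetP HF _ aH) andbb.
  by rewrite andbF.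
rewrite -cardsD; apply: eq_card => a; rewrite !inE.
by case: (a \in H); case: (u \in a); rewrite ?andbF.
Qed.

Definition edge_of (vs : nat -> V) (e : nat * nat) : {set V} :=
  [set vs e.1; vs e.2].

Definition embeds F (vs : nat -> V) (ps : seq (nat * nat)) :=
  [/\ uniq ps, {in ps, forall e, e.1 < e.2 /\ edge_of vs e \in F} &
      {in unzip1 ps ++ unzip2 ps &, injective vs}].

Lemma ends_mem (ps : seq (nat * nat)) e : e \in ps ->
  (e.1 \in unzip1 ps ++ unzip2 ps) * (e.2 \in unzip1 ps ++ unzip2 ps).
Proof. by move=> eps; rewrite !mem_cat !map_f ?orbT. Qed.

Lemma embeds_inj F vs ps : embeds F vs ps -> {in ps &, injective (edge_of vs)}.
Proof.
case=> _ psF vsI [a b] [c d] abP cdP /setP eab.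
have [[ltab _] [ltcd _]] := (psF _ abP, psF _ cdP).
have [aI bI] := ends_mem abP; have [cI dI] := ends_mem cdP.
have := eab (vs a); have := eab (vs b); have := eab (vs c).
rewrite /edge_of !inE !eqxx /= ?orbT.
rewrite !(inj_in_eq vsI) //=; move: ltab ltcd => /= ltab ltcd h1 h2 h3.
by congr (_, _); lia.
Qed.

Lemma embeds_pdeg F vs ps i : embeds F vs ps -> i \in unzip1 ps ++ unzip2 ps ->
  pdeg ps i <= degree [set a in F | a \in map (edge_of vs) ps] (vs i).
Proof.
move=> emb iI; have [ups psF vsI] := emb.
rewrite /pdeg -size_filter -(size_map (edge_of vs)) /degree cardE.
apply: uniq_leq_size.
  rewrite map_inj_in_uniq ?filter_uniq // => a b.
  by rewrite !mem_filter => /andP[_ aP] /andP[_ bP]; apply: embeds_inj emb _ _ aP bP.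
move=> a /mapP[e]; rewrite mem_filter mem_enum => /andP[ei eps] ->.
rewrite !inE map_f // (psF _ eps).2 /=.
by case/orP: ei => /eqP->; rewrite eqxx ?orbT.
Qed.

Lemma degree_subset F H u : H \subset F -> degree H u <= degree F u.
Proof.
move=> HF; apply: subset_leq_card; apply/subsetP => a; rewrite !inE.
by case/andP=> /(subsetP HF)-> ->.
Qed.

Lemma embeds_pdeg_le F vs ps i : embeds F vs ps ->
  i \in unzip1 ps ++ unzip2 ps -> pdeg ps i <= degree F (vs i).
Proof.
move=> emb iI; apply: leq_trans (embeds_pdeg emb iI) _.
by apply: degree_subset; apply/subsetP => a; rewrite inE => /andP[].
Qed.

(** Minimality colours the undeleted edges. A deleted edge loses at most one colour for each
    undeleted edge at either end, and at most degree minus [pdeg] of these are left there. *)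
Lemma deletion_reduction F D vs ps f :
  (forall H, H \proper F -> list_colourable H D) ->
  ps != [::] -> embeds F vs ps -> choosable ps f ->
  {in ps, forall e, f e <= D - (degree F (vs e.1) - pdeg ps e.1)
                             - (degree F (vs e.2) - pdeg ps e.2)} ->
  list_colourable F D.
Proof.
move=> minF ps0 emb chp fle L LD; have [ups psF vsI] := emb.
have einj := embeds_inj emb.
pose em := edge_of vs; pose H := [set a in F | a \in map em ps].
have HF : H \subset F by apply/subsetP => a; rewrite inE => /andP[].
have emH e : e \in ps -> em e \in H by move=> eps; rewrite inE map_f // (psF _ eps).2.
have properFH : F :\: H \proper F.
  rewrite properE subsetDl /=; case: (ps) ps0 emH => // e s _ emH.
  apply/subsetPn; exists (em e); last by rewrite inE emH ?mem_head.
  by apply: (subsetP HF); apply: emH; rewrite mem_head.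
have [a|C0 [C0L C0adj]] := minF _ properFH L.
  by rewrite inE => /andP[_ /LD].
pose near e := [set b in F :\: H | b :&: em e != set0].
pose L' e := [seq c <- L (em e) | c \notin map C0 (enum (near e))].
have [e eps | C1 [C1L C1adj]] := chp L'.
  have [uL leL] := LD _ (psF e eps).2; split; first exact: filter_uniq.
  apply: leq_trans (size_filter_notin _ uL); rewrite size_map -cardE.
  apply: leq_trans (fle e eps) _; rewrite -subnDA; apply: leq_sub => //.
  have [i1 i2] := ends_mem eps.
  apply: (@leq_trans (degree (F :\: H) (vs e.1) + degree (F :\: H) (vs e.2))).
    rewrite /degree -cardsUI; apply: leq_trans (leq_addr _ _).
    apply: subset_leq_card; apply/subsetP => b; rewrite !inE => /andP[-> /=].
    case/set0Pn => x; rewrite !inE => /andP[xb /orP[/eqP xe|/eqP xe]];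
      by rewrite -xe xb ?orbT.
  by rewrite !degreeD // leq_add // leq_sub2l // embeds_pdeg.
pose C a := if a \in H then C1 (nth (0, 0) ps (index a (map em ps))) else C0 a.
have CE e : e \in ps -> C (em e) = C1 e.
  move=> eps; rewrite /C emH //; congr C1.
  have ie : index (em e) (map em ps) < size ps by rewrite -(size_map em) index_mem map_f.
  by apply: einj; rewrite ?mem_nth //; rewrite -(nth_map _ set0) ?nth_index ?map_f.
have HP a : a \in H -> exists2 e, e \in ps & a = em e.
  by rewrite inE => /andP[_ /mapP].
have C1Near e b : e \in ps -> b \in F -> b \notin H -> b :&: em e != set0 -> C1 e != C0 b.
  move=> eps bF bH be; have := C1L e eps; rewrite mem_filter => /andP[+ _].
  apply: contraNneq => ->; apply: map_f.
  by rewrite mem_enum inE in_setD bH bF be.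
exists C; split=> [a aF | a b aF bF ab].
  have [aH | aH] := boolP (a \in H); last first.
    by rewrite /C (negPf aH) C0L // inE aH.
  have [e eps ->] := HP a aH; rewrite CE //.
  by have := C1L e eps; rewrite mem_filter => /andP[].
have [aH | aH] := boolP (a \in H); have [bH | bH] := boolP (b \in H).
- have [e eps ea] := HP a aH; have [e' e'ps eb] := HP b bH.
  rewrite ea eb !CE // => /set0Pn[x]; rewrite !inE => /andP[xe xe'].
  apply: C1adj => //; first by apply: contraNneq ab => e'e; rewrite ea eb e'e.
  have [i1 i2] := ends_mem eps; have [j1 j2] := ends_mem e'ps.
  rewrite /share; case/orP: xe => /eqP xe; case/orP: xe' => /eqP;
    by rewrite xe => /vsI->; rewrite ?eqxx ?orbT.
- have [e eps ea] := HP a aH; rewrite ea CE // /C (negPf bH) setIC.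
  exact: C1Near.
- have [e eps eb] := HP b bH; rewrite eb CE // /C (negPf aH) [C0 a == _]eq_sym.
  exact: C1Near.
- by rewrite /C (negPf aH) (negPf bH); apply: C0adj; rewrite // inE ?aH ?bH.
Qed.

End Reduction.

Lemma leq_add_subsub p d x n : p <= d -> d + x <= n -> p + x <= n - (d - p).
Proof. lia. Qed.

Lemma reducible_sub j u w ts : perm_eq (u ++ w) ts -> reducible j u ->
  reducible j ts.
Proof.
move=> pts /hasP[p pt /andP[lej /hasP[s sP con]]].
apply/hasP; exists p; rewrite // lej; apply/hasP; exists s => //.
apply/allP => r rp; apply: leq_trans (allP con r rp) _; rewrite !count_map.
by rewrite -(permP pts) count_cat leq_addr.
Qed.

(** All edges at the hub and at the y belong to the wheel, so only the x cost colours, at most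
    [7 - 3] each. *)
Lemma wheel6_budget (d : nat -> nat) : d 0 = 6 -> (forall i, d i <= 7) ->
  (forall k, k < 3 -> d (4 + k) = 3) ->
  {in wheel6, forall e, wheel6_size e <=
    7 - (d e.1 - pdeg wheel6 e.1) - (d e.2 - pdeg wheel6 e.2)}.
Proof.
move=> d0 d7 d3; have := (d3 0 isT, d3 1 isT, d3 2 isT).
move=> [[d4 d5] d6]; have := (d7 1, d7 2, d7 3) => -[[d1 d2] d'3].
apply/allP; rewrite /= /wheel6_size /= d0 d4 d5 d6.
by clear -d1 d2 d'3; do !(apply/andP; split) => //; lia.
Qed.

(** The hub has a fifth edge outside the wheel, which costs its spokes one colour; an x costs at
    most [6 - 3]. *)
Lemma wheel4_budget (d : nat -> nat) : d 0 = 5 -> (forall i, d i <= 6) ->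
  (forall k, k < 2 -> d (3 + k) = 3) ->
  {in wheel4, forall e, wheel4_size e <=
    6 - (d e.1 - pdeg wheel4 e.1) - (d e.2 - pdeg wheel4 e.2)}.
Proof.
move=> d0 d6 d3; have := (d3 0 isT, d3 1 isT) => -[d'3 d4].
have := (d6 1, d6 2) => -[d1 d2].
apply/allP; rewrite /= /wheel4_size /= d0 d'3 d4.
by clear -d1 d2; do !(apply/andP; split) => //; lia.
Qed.

(** * The neighbourhood of a big vertex *)

Section Configurations.

Variables (V : finType) (F : {set {set V}}) (D : nat).
Hypothesis cardF : {in F, forall a : {set V}, #|a| = 2}.
Hypothesis minF : forall H : {set {set V}}, H \proper F -> list_colourable H D.

Lemma edge_neq u w : [set u; w] \in F -> u != w.
Proof. by move/cardF; rewrite cards2; case: eqP. Qed.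

Definition nbr u := [set w | [set u; w] \in F].

Lemma degree_nbr u : degree F u = #|nbr u|.
Proof.
rewrite /degree -(card_in_imset (f := fun w => [set u; w])); last first.
  move=> w w'; rewrite !inE => /edge_neq uw _ /setP/(_ w).
  by rewrite !inE eqxx orbT [w == u]eq_sym (negPf uw) => /esym/eqP.
apply: eq_card => a; rewrite !inE; apply/andP/imsetP => [[aF ua] | [w]].
  have /cards2P[x [y [xy ea]]] := introT eqP (cardF aF).
  move: ua aF; rewrite ea !inE => /orP[]/eqP->; first by exists y; rewrite ?inE.
  by rewrite setUC; exists x; rewrite ?inE.
by rewrite inE => uw ->; rewrite uw !inE eqxx.
Qed.

(** Both degrees count the edge itself, so at most [D - 1] other edges meet it and it can be
    coloured last. *)
Lemma light_edge u w : [set u; w] \in F ->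
  degree F u + degree F w <= D.+1 -> list_colourable F D.
Proof.
move=> uwF led; pose vs i := if i == 0 then u else w.
have emb : embeds F vs [:: (0, 1)].
  split=> // [e|i i']; first by rewrite inE => /eqP->.
  have := edge_neq uwF; rewrite /vs !inE.
  by case: i => [|[]]; case: i' => [|[]] //= /eqP ne _ _ e; case: ne.
have d0 := embeds_pdeg_le (i := 0) emb isT.
have d1 := embeds_pdeg_le (i := 1) emb isT.
apply: (deletion_reduction (f := fun=> 1) minF _ emb) => //.
  exact: (@greedy_galvin_choosable [::] (fun=> 0)).
by move=> e; rewrite inE => /eqP-> /=; move: d0 d1; rewrite /pdeg /vs /=; lia.
Qed.

Variables (v : V) (xs : seq V).
Hypothesis uvx : uniq (v :: xs).
Hypothesis size_xs : size xs <= 3.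

(** With fewer than three x, the default [y] of [nth] yields [[set y; y]], which is never an
    edge. *)
Definition nbr_type y := [seq [set y; nth y xs i] \in F | i <- iota 0 3].

Definition attached y := [/\ y \notin v :: xs, [set v; y] \in F &
  {subset nbr y <= v :: xs}].

Lemma edge_self y : [set y; y] \in F = false.
Proof. by apply/negP => /edge_neq; rewrite eqxx. Qed.

Lemma degree_type y : attached y -> degree F y = (count id (nbr_type y)).+1.
Proof.
case=> yN vyF nbry; rewrite degree_nbr.
have -> : count id (nbr_type y) = count (mem (nbr y)) xs.
  rewrite count_map; have -> : 3 = size xs + (3 - size xs) by lia.
  rewrite iotaD count_cat -[in RHS](mkseq_nth y xs) count_map add0n addnC.
  rewrite -[LHS]/(_ + _) (@eq_in_count _ _ pred0 (iota (size xs) _)) ?count_pred0.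
    by apply: eq_count => i; rewrite /= inE.
  by move=> i; rewrite mem_iota /= => /andP[le _]; rewrite nth_default ?edge_self.
rewrite -size_filter -[RHS]/(size (v :: _)) cardE; apply/eqP.
rewrite -uniq_size_uniq ?enum_uniq //.
  move: uvx => /= /andP[vx ux]; rewrite filter_uniq // mem_filter andbT negb_and.
  by rewrite vx orbT.
move=> w; rewrite mem_enum inE mem_filter; have [->|wv] /= := eqVneq w v.
  by rewrite inE setUC vyF.
rewrite andb_idr // => wy; have := nbry _ wy; rewrite inE.
by case/predU1P => // ew; rewrite ew eqxx in wv.
Qed.

Hypothesis degF : forall u, degree F u <= D.

(** All edges at a row vertex are deleted, so its edge to z keeps [D - (degree F z - pdeg z)]
    colours: at least [pdeg z] at an x, and [j] more than that at v. *)
Lemma table_reduction j ys : degree F v + j = D -> uniq ys ->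
  {in ys, forall y, attached y} -> reducible j (map nbr_type ys) ->
  list_colourable F D.
Proof.
move=> degv uys attys /hasP[[j' M] Mtab] /andP[lej /hasP[s sP]].
rewrite /contains -map_comp => /allP/sub_rows-[zs [ezs subzs /(_ uys) uzs]].
have := allP galvin_table_checked _ Mtab.
case/andP=> /andP[/andP[uM M0] /= orM] /allP rowM.
have szs : size zs = size M by rewrite -(size_map pattern M) -ezs size_map.
have : all (perm_eq (iota 0 3)) perms3 by [].
move=> /allP/(_ s sP) perms.
have us : uniq s by rewrite -(perm_uniq perms) iota_uniq.
have szs3 : size s = 3 by rewrite -(perm_size perms).
have s3 : {in s, forall k, k < 3}.
  by move=> k; rewrite -(perm_mem perms) mem_iota.
(* Column [z.+1] stands for the x of index [nth 0 s z]. *)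
pose vs i := if i == 0 then v else if i < 4 then nth v xs (nth 0 s i.-1)
  else nth v zs (i - 4).
have entP e : e \in matrix_edges M -> exists i z,
    [/\ e = (z, 4 + i), i < size M, z < 4 & 0 < entry M i z].
  case/allpairsPdep=> i [z []]; rewrite mem_iota mem_filter mem_iota.
  by move=> iM /and3P[z0 _ z4] ->; exists i, z.
have attz i : i < size M -> attached (nth v zs i).
  by move=> iM; apply/attys/subzs/mem_nth; rewrite szs.
have colM i z : i < size M -> z < 3 -> (0 < entry M i z.+1) =
    ([set nth v zs i; nth (nth v zs i) xs (nth 0 s z)] \in F).
  move=> iM z3; set y := nth v zs i.
  have /eqP size_row : size (nth [::] M i) == 4.
    by have := rowM i; rewrite mem_iota iM => /(_ isT)/and3P[].
  have := congr1 (fun l => nth false (nth [::] l i) z) ezs.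
  rewrite (nth_map v) ?szs // (nth_map [::]) // /pattern /permute -/y /=.
  rewrite (nth_map 0) ?szs3 // (nth_map 0) ?size_behead ?size_row // nth_behead.
  by rewrite (nth_map 0) ?size_iota ?s3 ?mem_nth ?szs3 // nth_iota ?s3 ?mem_nth ?szs3.
have ltxs i z : i < size M -> z < 3 -> 0 < entry M i z.+1 -> nth 0 s z < size xs.
  move=> iM z3; rewrite colM //; apply: contraTT; rewrite -leqNgt => le.
  by rewrite (nth_default _ le) edge_self.
have usedP a : a \in unzip1 (matrix_edges M) ++ unzip2 (matrix_edges M) ->
    [\/ a = 0, exists2 z, a = z.+1 & z < 3 /\ nth 0 s z < size xs |
     exists2 i, a = 4 + i & i < size M].
  rewrite mem_cat => /orP[]/mapP[e /entP[i [z [-> iM z4 zM]]] ->] /=; last first.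
    by constructor 3; exists i.
  case: z z4 zM => [|z] z3 zM; first by constructor 1.
  by constructor 2; exists z => //; split=> //; apply: ltxs zM.
have vsS z : z < 3 -> vs z.+1 = nth v xs (nth 0 s z) by case: z => [|[|[|]]].
have vs4 i : vs (4 + i) = nth v zs i by rewrite /vs /= addKn.
have /= /andP[vxs uxs] := uvx.
have vsI : {in unzip1 (matrix_edges M) ++ unzip2 (matrix_edges M) &, injective vs}.
  have zsN i : i < size M -> (nth v zs i != v) * (nth v zs i \notin xs).
    by move=> /attz[]; rewrite inE negb_or => /andP[-> ->].
  have xsN k : k < size xs -> nth v xs k != v.
    by move=> kxs; apply: contraNneq vxs => <-; rewrite mem_nth.
  move=> a b /usedP[->|[z -> [z3 zx]]|[i -> iM]] /usedP[->|[z' -> [z3' zx']]|[i' -> iM']];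
    rewrite ?vs4 ?vsS //.
  - by move/esym/eqP; rewrite (negPf (xsN _ zx')).
  - by move/esym/eqP; rewrite (negPf (zsN _ iM').1).
  - by move/eqP; rewrite (negPf (xsN _ zx)).
  - move/eqP; rewrite nth_uniq // nth_uniq ?szs3 // => /eqP-> //.
  - by move=> e; have := (zsN _ iM').2; rewrite -e mem_nth.
  - by move/eqP; rewrite (negPf (zsN _ iM).1).
  - by move=> e; have := (zsN _ iM).2; rewrite e mem_nth.
  - by move/eqP; rewrite nth_uniq ?szs // => /eqP->.
have emb : embeds F vs (matrix_edges M).
  split; [exact: uM | move=> e /entP[i [z [-> iM z4 zM]]] | exact: vsI].
  split=> /=; first exact: ltn_addr.
  rewrite /edge_of /= vs4; case: z z4 zM => [|z] z3 zM.
    by have [_ ] := attz i iM.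
  rewrite vsS // setUC.
  have -> : nth v xs (nth 0 s z) = nth (nth v zs i) xs (nth 0 s z).
    by apply: set_nth_default; apply: ltxs zM.
  by rewrite -colM.
apply: (deletion_reduction minF M0 emb (galvin_choosable orM)).
move=> e eM; have [i1 i2] := ends_mem eM.
have p1 := embeds_pdeg_le emb i1; have p2 := embeds_pdeg_le emb i2.
have [i [z [ee iM z4 zM]]] := entP e eM; rewrite ee /= in p1 p2 *.
(* Both sides count v and the neighbours among the x; permuting the x does not change the count. *)
have -> : degree F (vs (4 + i)) = pdeg (matrix_edges M) (4 + i).
  have := rowM i; rewrite mem_iota iM => /(_ isT)/and3P[_ _ /eqP->].
  rewrite vs4 degree_type; last exact: attz.
  have := congr1 (fun l => count id (nth [::] l i)) ezs.
  rewrite (nth_map v) ?szs // (nth_map [::]) // => <-; congr S.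
  rewrite -[in LHS](mkseq_nth false (nbr_type (nth v zs i))).
  by have /permP := perm_map (nth false (nbr_type (nth v zs i))) perms; apply.
rewrite subnn subn0 /extra.
apply: leq_add_subsub => //; case: eqP p1 => [-> _|_ _]; last first.
  by rewrite addn0 degF.
by rewrite -[X in _ <= X]degv leq_add.
Qed.

Lemma cover_reduction j n ts ys : unavoidable (reducible j) n ts [::] ->
  n <= size ys -> {subset map nbr_type ys <= ts} -> degree F v + j = D ->
  uniq ys -> {in ys, forall y, attached y} -> list_colourable F D.
Proof.
rewrite -(size_map nbr_type) => /unavoidableP cov /cov covts /covts[u [w [pu redu]]].
move=> degv uys attys; apply: table_reduction degv uys attys _.
exact: reducible_sub pu redu.
Qed.

Lemma embeds_nth (s : seq V) ps : uniq s -> uniq ps ->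
  all (fun e => (e.1 < e.2) && (e.2 < size s)) ps ->
  {in ps, forall e, edge_of (nth v s) e \in F} -> embeds F (nth v s) ps.
Proof.
move=> us ups /allP lts edgeF.
have lt_size i : i \in unzip1 ps ++ unzip2 ps -> i < size s.
  rewrite mem_cat.
  case/orP=> [/mapP[e /lts/andP[lt12 lt2] ->] | /mapP[e /lts/andP[_ lt2] ->] //].
  exact: ltn_trans lt12 lt2.
split=> // [e eps | i i' /lt_size lti /lt_size lti' /eqP].
  by have /andP[] := lts e eps; split=> //; apply: edgeF.
by rewrite nth_uniq // => /eqP.
Qed.

Lemma edge_type y i : (i < 3) ->
  ([set y; nth y xs i] \in F) = nth false (nbr_type y) i.
Proof. by case: i => [|[|[|]]]. Qed.

Lemma wheel6_reduction ys : size xs = 3 -> size ys = 3 -> uniq ys ->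
  {in ys, forall y, attached y} -> {subset xs <= nbr v} ->
  map nbr_type ys = [:: [:: false; true; true]; [:: true; false; true];
                       [:: true; true; false]] ->
  D = 7 -> degree F v = 6 -> list_colourable F D.
Proof.
move=> sx sy uys attys xsv eys eD degv.
pose s := v :: xs ++ ys.
have us : uniq s.
  rewrite /s -cat_cons cat_uniq uvx uys andbT.
  by apply/hasPn => y /attys[].
have sv i : i < 3 -> [set nth v s 0; nth v s i.+1] \in F.
  move=> i3; rewrite /= nth_cat sx i3.
  by have := xsv (nth v xs i); rewrite mem_nth ?sx // inE => /(_ isT).
have sys k : k < 3 -> nth v s (4 + k) = nth v ys k.
  by move=> k3; rewrite /= nth_cat sx /= addKn.
have atk k : k < 3 -> attached (nth v ys k).
  by move=> k3; apply: attys; rewrite mem_nth ?sy.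
have sy0 k : k < 3 -> [set nth v s 0; nth v s (4 + k)] \in F.
  by move=> k3; rewrite sys //; have [] := atk k k3.
have typk k : k < 3 -> nbr_type (nth v ys k) = nth [::] [:: [:: false; true; true];
    [:: true; false; true]; [:: true; true; false]] k.
  by move=> k3; rewrite -eys (nth_map v) ?sy.
have sxy i k : i < 3 -> k < 3 -> i != k -> [set nth v s i.+1; nth v s (4 + k)] \in F.
  move=> i3 k3 ik; rewrite sys // setUC [nth v s _]/= nth_cat sx i3.
  have -> : nth v xs i = nth (nth v ys k) xs i by apply: set_nth_default; rewrite sx.
  rewrite edge_type // typk //.
  by case: i i3 ik => [|[|[|]]] // _; case: k k3 => [|[|[|]]].
have degk k : k < 3 -> degree F (nth v s (4 + k)) = 3.
  move=> k3; rewrite sys // degree_type; last exact: atk.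
  by rewrite typk //; case: k k3 => [|[|[|]]].
have emb : embeds F (nth v s) wheel6.
  apply: embeds_nth => //; first by rewrite /= size_cat sx sy.
  apply/allP; rewrite /edge_of [all _ _]/=.
  by rewrite !(sv 0, sv 1, sv 2, sy0 0, sy0 1, sy0 2, sxy 0 1, sxy 0 2, sxy 1 0,
    sxy 1 2, sxy 2 0, sxy 2 1).
apply: (deletion_reduction minF _ emb wheel6_choosable) => //.
rewrite eD; apply: (wheel6_budget (d := fun i => degree F (nth v s i))) => //.
by rewrite -eD.
Qed.

Lemma wheel4_reduction ys : size xs = 2 -> size ys = 2 -> uniq ys ->
  {in ys, forall y, attached y} -> {subset xs <= nbr v} ->
  {in ys, forall y, nbr_type y = [:: true; true; false]} ->
  D = 6 -> degree F v = 5 -> list_colourable F D.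
Proof.
move=> sx sy uys attys xsv typ eD degv.
pose s := v :: xs ++ ys.
have us : uniq s.
  rewrite /s -cat_cons cat_uniq uvx uys andbT.
  by apply/hasPn => y /attys[].
have sys k : k < 2 -> nth v s (3 + k) = nth v ys k.
  by move=> k2; rewrite /= nth_cat sx /= addKn.
have ysk k : k < 2 -> nth v ys k \in ys by move=> k2; rewrite mem_nth ?sy.
have sv i : i < 2 -> [set nth v s 0; nth v s i.+1] \in F.
  move=> i2; rewrite /= nth_cat sx i2.
  by have := xsv (nth v xs i); rewrite mem_nth ?sx // inE => /(_ isT).
have svy k : k < 2 -> [set nth v s 0; nth v s (3 + k)] \in F.
  by move=> k2; rewrite sys //; have [] := attys _ (ysk k k2).
have sxy i k : i < 2 -> k < 2 -> [set nth v s i.+1; nth v s (3 + k)] \in F.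
  move=> i2 k2; rewrite sys // setUC [nth v s _]/= nth_cat sx i2.
  have -> : nth v xs i = nth (nth v ys k) xs i by apply: set_nth_default; rewrite sx.
  by rewrite edge_type ?typ ?ysk ?(ltn_trans i2) //; case: i i2 => [|[]].
have emb : embeds F (nth v s) wheel4.
  apply: embeds_nth => //; first by rewrite /= size_cat sx sy.
  apply/allP; rewrite /edge_of [all _ _]/=.
  by rewrite !(sv 0, sv 1, svy 0, svy 1, sxy 0 0, sxy 0 1, sxy 1 0, sxy 1 1).
apply: (deletion_reduction minF _ emb wheel4_choosable) => //.
rewrite eD; apply: (wheel4_budget (d := fun i => degree F (nth v s i))) => //.
  by rewrite -eD.
by move=> k k2; rewrite sys // degree_type ?typ ?ysk //; apply: attys; apply: ysk.
Qed.

Variables (k : nat) (Z : {set V}).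
Hypotheses (cardZ : #|Z| <= k) (xsZ : {subset xs <= Z}).
Hypothesis bigv : k < degree F v.
Hypothesis nbrv : forall w, w \in nbr v -> w \notin Z ->
  degree F w <= k /\ {subset nbr w <= v :: xs}.
Hypothesis heavy : forall u w, [set u; w] \in F ->
  D.+2 <= degree F u + degree F w.

(** [Z] will be a bag of v without v, so at most [k] neighbours of v are missing here. *)
Let ys := enum (nbr v :\: Z).

Lemma ys_attached : {in ys, forall y, attached y}.
Proof.
move=> y; rewrite mem_enum inE => /andP[yZ yv].
have [_ ?] := nbrv yv yZ; split=> //; last by rewrite inE in yv.
rewrite inE negb_or (contra (@xsZ y)) // andbT; apply: contraTneq yv => ->.
by rewrite inE edge_self.
Qed.

Lemma size_ys : size ys + #|nbr v :&: Z| = degree F v.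
Proof. by rewrite -cardE addnC cardsID degree_nbr. Qed.

Lemma card_nbrZ : #|nbr v :&: Z| <= k.
Proof. exact: leq_trans (subset_leq_card (subsetIr _ _)) cardZ. Qed.

Lemma typesP t a b : size t = 3 -> a <= count id t <= b -> t \in types a b.
Proof.
move=> t3 ct; rewrite mem_filter ct.
by case: t t3 {ct} => [|[] [|[] [|[] []]]].
Qed.

(** As vy is heavy and y small, the degree of y lies between [D + 2 - degree F v] and [k]; its type
    leaves v out. *)
Lemma ys_types y : y \in ys -> nbr_type y \in types (D - degree F v).+1 k.-1.
Proof.
move=> yy; have att := ys_attached yy; apply: typesP => //.
have := degree_type att; move: yy; rewrite mem_enum inE => /andP[yZ yv] dy.
have [lek _] := nbrv yv yZ; have := heavy (u := v) (w := y).
rewrite inE in yv; rewrite yv => /(_ isT); move: lek; rewrite dy.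
by have := degF v; move: (count id _) (degree F v) => c d; clear; lia.
Qed.

Lemma ys_gt0 : 0 < size ys.
Proof.
have := size_ys; have := card_nbrZ; move: bigv; case: (size ys) => //.
by clear; lia.
Qed.

Lemma ys_deficiency : (D - degree F v).+2 <= k.
Proof.
have : exists y, y \in ys by case: ys ys_gt0 => // y s; exists y; rewrite mem_head.
case=> y /ys_types; rewrite mem_filter => /andP[+ _].
by clear; lia.
Qed.

Lemma cover_ys n j ts : unavoidable (reducible j) n ts [::] ->
  {subset types j.+1 k.-1 <= ts} -> D - degree F v = j -> n <= size ys ->
  list_colourable F D.
Proof.
move=> un sub ej leq_n.
have degv : degree F v + j = D by rewrite -ej subnKC.
apply: (cover_reduction un leq_n _ degv (enum_uniq _) ys_attached).
by move=> t /mapP[y yy ->]; apply: sub; rewrite -ej ys_types.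
Qed.

(** In the tight case v is adjacent to all of [Z]; this supplies the spokes from the hub to the
    x. *)
Lemma ys_full : size ys + k = degree F v -> #|Z| = k /\ {subset xs <= nbr v}.
Proof.
move=> eyk; have := size_ys; rewrite -eyk => /addnI eIk.
have eIZ : nbr v :&: Z = Z.
  by apply/eqP; rewrite eqEcard subsetIr eIk cardZ.
split=> [|x /xsZ]; first by rewrite -eIZ.
by rewrite -eIZ inE => /andP[].
Qed.

Lemma tree_case : k = 3 -> #|Z| <= size xs -> 7 <= D -> list_colourable F D.
Proof.
move=> k3 leZ leD; have leI := card_nbrZ; have eys := size_ys.
have def := ys_deficiency; have degv := degF v; rewrite k3 in leI def.
have [d0 | d1] : D - degree F v = 0 \/ D - degree F v = 1 by lia.
  apply: (cover_ys unavoidable_tree0 _ d0); first by rewrite k3.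
  by clear -leI eys degv leD d0; lia.
(* Fewer than four y force the tight case [D = 7], [degree F v = 6], where the wheel can occur. *)
have [le4 | lt4] := leqP 4 (size ys).
  by apply: (cover_ys unavoidable_tree1' _ d1 le4); rewrite k3.
have [y3 D7 v6] : [/\ size ys = 3, D = 7 & degree F v = 6].
  by clear -leI eys degv leD d1 lt4; split; lia.
have [Z3 xsv] : #|Z| = 3 /\ {subset xs <= nbr v}.
  by rewrite -k3; apply: ys_full; rewrite k3 y3 v6.
have types_ys : {subset map nbr_type ys <= types 2 2}.
  by move=> t /mapP[y /ys_types + ->]; rewrite d1 k3.
have [|u [w [pu]]] := unavoidableP unavoidable_tree1 _ types_ys.
  by rewrite size_map y3.
case/orP=> [redu | pairs].
  apply: (@table_reduction 1 ys); last exact: reducible_sub pu redu.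
  - by rewrite v6 D7.
  - exact: enum_uniq.
  - exact: ys_attached.
have w0 : w = [::].
  have := perm_size pu; rewrite size_cat (perm_size pairs) size_map y3.
  by case: (w).
rewrite w0 cats0 in pu; set rows := [:: [:: false; true; true];
  [:: true; false; true]; [:: true; true; false]].
have prows : perm_eq rows (map nbr_type ys).
  by rewrite (perm_trans _ pu) // perm_sym (perm_trans pairs).
have [zs [ezs subzs /(_ (enum_uniq _)) uzs]] : exists zs,
    [/\ map nbr_type zs = rows, {subset zs <= ys} & uniq ys -> uniq zs].
  by apply: sub_rows => r _; rewrite (permP prows).
apply: (wheel6_reduction _ _ uzs _ xsv ezs D7 v6).
- by apply/eqP; rewrite eqn_leq size_xs -{1}Z3.
- by rewrite -(size_map nbr_type) ezs.
- by move=> z /subzs/ys_attached.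
Qed.

Lemma path3_case : k = 3 -> size xs <= 2 -> 6 <= D -> list_colourable F D.
Proof.
move=> k3 xs2 leD; have leI := card_nbrZ; have eys := size_ys.
have def := ys_deficiency; have degv := degF v; rewrite k3 in leI def.
have typ2 y : nth false (nbr_type y) 2 = false.
  by rewrite -edge_type // nth_default ?edge_self.
have typ_ys : {subset map nbr_type ys <= types_path3 (D - degree F v).+1}.
  by move=> t /mapP[y /ys_types + ->]; rewrite k3 !mem_filter typ2 => /andP[-> ->].
have un n j : unavoidable (reducible j) n (types_path3 j.+1) [::] ->
    D - degree F v = j -> n <= size ys -> list_colourable F D.
  move=> un ej leq_n; rewrite ej in typ_ys.
  apply: (cover_reduction un leq_n typ_ys _ (enum_uniq _) ys_attached).
  by rewrite -ej subnKC.
have [d0 | d1] : D - degree F v = 0 \/ D - degree F v = 1 by lia.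
  by apply: (un _ _ unavoidable_path3_0 d0); clear -leI eys degv leD d0; lia.
have [le3 | lt3] := leqP 3 (size ys).
  exact: (un _ _ unavoidable_path3_1 d1 le3).
have [y2 D6 v5] : [/\ size ys = 2, D = 6 & degree F v = 5].
  by clear -leI eys degv leD d1 lt3; split; lia.
have [Z3 xsv] : #|Z| = 3 /\ {subset xs <= nbr v}.
  by rewrite -k3; apply: ys_full; rewrite k3 y2 v5.
have type_ys y : y \in ys -> nbr_type y = [:: true; true; false].
  move=> yy; have := typ_ys _ (map_f nbr_type yy); rewrite d1 /types_path3 mem_filter.
  have -> : types 2 2 = [:: [:: true; true; false]; [:: true; false; true];
    [:: false; true; true]] by [].
  by rewrite !inE; case/andP=> + /or3P[] /eqP e; rewrite e.
apply: (wheel4_reduction _ y2 (enum_uniq _) ys_attached xsv type_ys D6 v5).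
(* Some y is joined to two x, so there are exactly two. *)
have : exists y, y \in ys by case: ys y2 => // y s; exists y; rewrite mem_head.
case=> y yy; apply/eqP; rewrite eqn_leq xs2 leqNgt; apply/negP => xs1.
by have := edge_type y (i := 1) isT; rewrite type_ys // nth_default ?edge_self.
Qed.

Lemma path4_case : k = 4 -> 10 <= D -> list_colourable F D.
Proof.
move=> k4 leD; have leI := card_nbrZ; have eys := size_ys.
have def := ys_deficiency; have degv := degF v; rewrite k4 in leI def.
have [d0|d1|d2] : [\/ D - degree F v = 0, D - degree F v = 1 | D - degree F v = 2].
- move: def; case: (D - _) => [|[|[|]]] // _;
    by [constructor 1 | constructor 2 | constructor 3].
- apply: (cover_ys unavoidable_path4_0 _ d0); first by rewrite k4.
  by clear -leI eys degv leD d0; lia.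
- apply: (cover_ys unavoidable_path4_1 _ d1); first by rewrite k4.
  by clear -leI eys degv leD d1; lia.
- apply: (cover_ys unavoidable_path4_2 _ d2); first by rewrite k4.
  by clear -leI eys degv leD d2; lia.
Qed.

End Configurations.

(** * Deepest vertices of a decomposition *)

Section Trees.

Variable T : sgraph.
Hypothesis acyclic : forall c : seq T, ucycle (@adj T) c -> size c < 3.

Definition path_in (S : {set T}) x q :=
  [/\ path (@adj T) x q, uniq (x :: q) & {subset x :: q <= S}].

Definition connected_in (S : {set T}) :=
  {in S &, forall x y, exists2 q, path_in S x q & last x q = y}.

Definition leaf_in (S : {set T}) l p :=
  [/\ l \in S, p \in S, l != p & {in S, forall x, adj l x -> x = p}].

(** The first vertex of a longest path is a leaf: a neighbour off the path would extend it, one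
    beyond the second vertex would close a cycle. *)
Lemma leaf_exists (S : {set T}) : connected_in S -> 1 < #|S| ->
  exists l p, leaf_in S l p.
Proof.
move=> conS /card_gt1P[a [b [aS bS ab]]].
have [q qS eb] := conS a b aS bS.
have {eb ab aS} q0 : 0 < size q.
  by case: q eb {qS} => //= e; rewrite e eqxx in ab.
have [x [y [q' [xqS maxq]]]] : exists x y q, path_in S x (y :: q) /\
    forall x' q', path_in S x' q' -> size q' <= size (y :: q).
  suff : exists x q0, [/\ path_in S x q0, 0 < size q0 &
      forall x' q', path_in S x' q' -> size q' <= size q0].
    by case=> x [[|y q1] [xq // _ mx]]; exists x, y, q1.
  have bound x q1 : path_in S x q1 -> size q1 <= #|S|.
    case=> _ uq sq; rewrite cardE -ltnS; apply: (@leq_trans (size (x :: q1))) => //.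
    by apply: leqW; apply: uniq_leq_size => // z /sq; rewrite mem_enum.
  have [m] := ubnP (#|S| - size q); elim: m a q qS q0 => // m IHm a q qS q0 ltm.
  case: (boolp.pselect (exists x q1, path_in S x q1 /\ size q < size q1)).
    case=> x [q1 [xq1 lt]]; apply: (IHm x q1) => //; first exact: leq_ltn_trans lt.
    have := bound x q1 xq1; lia.
  move=> no; exists a, q; split=> // x q1 xq1; rewrite leqNgt; apply/negP => lt.
  by apply: no; exists x, q1.
have [pq uq sq] := xqS.
exists x, y; split.
- by apply: sq; rewrite mem_head.
- by apply: sq; rewrite !inE eqxx orbT.
- by move: uq => /= /andP[]; rewrite inE negb_or => /andP[].
move=> z zS xz.
have zx : z != x by apply: contraTneq xz => ->; rewrite adj_irr.
have [zq | zq] := boolP (z \in y :: q'); last first.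
  suff : path_in S z [:: x, y & q'] by move/maxq; rewrite ltnn.
  split.
  - by rewrite /= adj_sym xz.
  - by rewrite cons_uniq uq inE negb_or zx zq.
  - by move=> u; rewrite inE => /predU1P[-> | /sq].
move: zq; rewrite inE => /predU1P[// | zq'].
move: pq uq {maxq xqS sq}; case/splitPr: q' / zq' => q1 q2.
rewrite -cat_cons -cat_rcons => pq uq.
have : ucycle (@adj T) (x :: rcons (y :: q1) z).
  rewrite /ucycle /cycle rcons_path last_rcons adj_sym xz andbT.
  move: pq uq; rewrite cat_path -cat_cons cat_uniq => /andP[-> _] /and3P[-> _ _].
  by [].
by move/acyclic; rewrite /= size_rcons.
Qed.

(** A path running through a leaf would enter and leave it by the same neighbour. *)
Lemma connected_leaf S l p : connected_in S -> leaf_in S l p ->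
  connected_in (S :\ l).
Proof.
move=> conS [lS pS lp leafl] x y; rewrite !inE => /andP[xl xS] /andP[yl yS].
have [q [pq uq sq] eq] := conS x y xS yS; exists q => //; split=> //.
suff lN : l \notin x :: q.
  by move=> z zq; rewrite !inE sq // andbT; apply: contraNneq lN => <-.
apply/negP; rewrite inE eq_sym (negPf xl) /= => lq.
move: pq uq sq eq; case/splitPr: q / lq => q1 q2.
rewrite cat_path last_cat -cat_cons cat_uniq /= => /and3P[_ e1 p2] /and3P[_ dis u2].
case: q2 p2 dis u2 => [|z q2] /=; first by move=> _ _ _ _ e; rewrite e eqxx in yl.
move=> /andP[e2 _] dis _ sq _.
have z1 : z = p by apply: leafl => //; apply: sq; rewrite inE mem_cat !inE eqxx !orbT.
have z2 : last x q1 = p.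
  apply: leafl; last by rewrite adj_sym.
  apply: sq; have := mem_last x q1; rewrite !inE mem_cat => /orP[] -> //.
  by rewrite orbT.
move: dis; rewrite z1 -z2 !negb_or => /and3P[_ + _].
by rewrite -negb_or -[_ || _]/(last x q1 \in x :: q1) mem_last.
Qed.

Variables (V : finType) (B : T -> {set V}).
Hypothesis interpolation : forall v t1 q, path (@adj T) t1 q -> uniq (t1 :: q) ->
  v \in B t1 -> v \in B (last t1 q) -> forall t, t \in t1 :: q -> v \in B t.

Lemma leaf_bag S l p w s : connected_in S -> leaf_in S l p ->
  s \in S -> s != l -> w \in B l -> w \in B s -> w \in B p.
Proof.
move=> conS [lS _ _ leafl] sS sl wl ws.
have [[|h q] [pq uq sq] eq] := conS l s lS sS; first by rewrite -eq eqxx in sl.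
have <- : h = p.
  apply: leafl; first by apply: sq; rewrite !inE eqxx orbT.
  by move: pq => /= /andP[].
by apply: (interpolation pq uq wl); rewrite ?eq // !inE eqxx orbT.
Qed.

(* Peel off leaves [l] until a vertex of [W] occurs in the bag of [l] only. *)
Lemma tree_deepest (S : {set T}) (W : {set V}) : connected_in S ->
  W != set0 -> {in W, forall v, exists2 t, t \in S & v \in B t} ->
  exists t v, [/\ v \in W, v \in B t &
    {in S, forall s, v \in B s -> forall w, w \in B s -> w \notin B t ->
       w \notin W /\ {in S, forall s', w \in B s' -> B s' :&: W \subset B t}}].
Proof.
have [n] := ubnP #|S|; elim: n S => // n IHn S leSn conS W0 covW.
have [v0 v0W] := set0Pn _ W0; have [t0 t0S v0t0] := covW v0 v0W.
have [S1 | ] := leqP #|S| 1.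
  have eS t : t \in S -> t = t0.
    by move=> tS; move/card_le1_eqP: S1; apply.
  by exists t0, v0; split=> // s /eS-> _ w ->.
case/(leaf_exists conS) => l [p lp]; have [lS pS nlp leafl] := lp.
(* A vertex of [W] in [B l] but not in [B p] occurs nowhere else in [S], so [B l] is the bag sought;
   otherwise [l] is cut off. *)
have [sub | /subsetPn[v]] := boolP (B l :&: W \subset B p); last first.
  rewrite inE => /andP[vl vW] vp; exists l, v; split=> // s sS vs w ws wl.
  have [esl | sl] := eqVneq s l; first by rewrite -esl ws in wl.
  by have := leaf_bag conS lp sS sl vl vs; rewrite (negPf vp).
have [||t [v [vW vt tP]]] := IHn (S :\ l) _ (connected_leaf conS lp) W0.
- by rewrite -ltnS; apply: leq_trans leSn; rewrite [#|S|](cardsD1 l) lS.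
- move=> v vW; have [s sS vs] := covW v vW.
  have [esl | sl] := eqVneq s l; last by exists s; rewrite // !inE sl.
  exists p; first by rewrite !inE eq_sym nlp.
  by apply: (subsetP sub); rewrite inE vW -esl vs.
have pS' : p \in S :\ l by rewrite !inE eq_sym nlp.
have toW x y : v \in B x -> x \in S :\ l -> y \in B x -> y \in W -> y \in B t.
  move=> vx xS yx yW; apply: contraT => yt.
  by have [] := tP x xS vx y yx yt; rewrite yW.
exists t, v; split=> // s sS vs w ws wt.
have [esl | sl] := eqVneq s l.
  rewrite {s sS}esl in vs ws.
  (* All vertices of [W] in [B l] are in [B p] too, so the properties known at [p] settle the bag of
     [l]. *)
  have vp : v \in B p by apply: (subsetP sub); rewrite inE vs.
  have subt : B l :&: W \subset B t.
    apply/subsetP => x xl; apply: (toW p) => //; first exact: (subsetP sub).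
    by move: xl; rewrite inE => /andP[].
  have [wp | wp] := boolP (w \in B p).
    have [wW wS] := tP p pS' vp w wp wt; split=> // s' s'S ws'.
    have [-> // | s'l] := eqVneq s' l.
    by apply: wS => //; rewrite !inE s'l.
  split.
    by apply: contra wp => wW; apply: (subsetP sub); rewrite inE ws.
  move=> s' s'S ws'; have [-> // | s'l] := eqVneq s' l.
  by have := leaf_bag conS lp s'S s'l ws ws'; rewrite (negPf wp).
have sS' : s \in S :\ l by rewrite !inE sl.
have [wW wS] := tP s sS' vs w ws wt; split=> // s' s'S ws'.
have [es'l | s'l] := eqVneq s' l; last by apply: wS => //; rewrite !inE s'l.
rewrite es'l in ws' *; have wp := leaf_bag conS lp sS sl ws' ws.
apply: subset_trans (wS p pS' wp); rewrite subsetI sub.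
by apply: subsetIr.
Qed.

End Trees.

(** * Path decompositions *)

Section Paths.

Variables (T : sgraph) (s : seq T) (t0 : T).
Hypotheses (us : uniq s) (sT : s =i T).
Hypothesis adj_index : forall x y : T, adj x y =
  ((index x s).+1 == index y s) || ((index y s).+1 == index x s).
Variables (V : finType) (B : T -> {set V}) (k : nat).
Hypothesis interpolation : forall v t1 q, path (@adj T) t1 q -> uniq (t1 :: q) ->
  v \in B t1 -> v \in B (last t1 q) -> forall t, t \in t1 :: q -> v \in B t.
Hypothesis width : forall t, #|B t| <= k.+1.
Hypothesis k_gt0 : 0 < k.

Let bag i := B (nth t0 s i).

Lemma bag_index t : B t = bag (index t s).
Proof. by rewrite /bag nth_index // sT. Qed.

Lemma index_lt (t : T) : index t s < size s.
Proof. by rewrite index_mem sT. Qed.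

Lemma bag_interval v i j l : i <= j -> j <= l -> l < size s ->
  v \in bag i -> v \in bag l -> v \in bag j.
Proof.
move=> ij jl ls vi vl; pose q := map (nth t0 s) (iota i.+1 (l - i)).
have lt_size n : n \in i :: iota i.+1 (l - i) -> n < size s.
  by rewrite -[_ :: _]/(iota i (l - i).+1) mem_iota; lia.
have := @interpolation v (nth t0 s i) q; apply => //.
- rewrite /q {q}; have : i + (l - i) < size s by lia.
  move: (l - i) {lt_size} => d; elim: d i {ij vi} => //= d IHd i lt.
  have lt1 : i.+1 < size s by apply: leq_ltn_trans lt; rewrite addnS ltnS leq_addr.
  by rewrite IHd ?addSnnS // adj_index !index_uniq ?eqxx // ltnW.
- rewrite -map_cons map_inj_in_uniq ?iota_uniq; last first.
    by move=> x y /lt_size xs /lt_size ys /eqP; rewrite nth_uniq // => /eqP.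
  exact: (iota_uniq i (l - i).+1).
- rewrite /q last_map; suff -> : last i (iota i.+1 (l - i)) = l by [].
  rewrite (last_nth i) size_iota -[_ :: _]/(iota i (l - i).+1) nth_iota //.
  exact: subnKC (leq_trans ij jl).
rewrite -map_cons; apply: map_f.
by rewrite -[_ :: _]/(iota i (l - i).+1) mem_iota; lia.
Qed.

(* [t] is the first bag after which a vertex [v] of [W] disappears.  Bags before
   [t] lose no vertex of [W], so [X] can be taken from the last of those that
   contain a vertex outside [W], and therefore at most [k] vertices of [W]. *)
Lemma path_deepest (W : {set V}) : W != set0 ->
  {in W, forall v, exists t, v \in B t} ->
  exists t v (X : {set V}), [/\ v \in W, v \in X, X \subset B t, #|X| <= k &
    forall s', v \in B s' -> forall w, w \in B s' -> w \notin B t ->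
       w \notin W /\ forall s'', w \in B s'' -> B s'' :&: W \subset X].
Proof.
move=> W0 covW.
pose ends i := (i < size s) && [exists v in W, (v \in bag i) &&
  all (fun j => v \notin bag j) (iota i.+1 (size s - i.+1))].
have ends_after u j : u \in W -> j < size s -> u \in bag j ->
    exists i, [/\ ends i, j <= i & u \in bag i].
  move=> uW js uj.
  have exP : exists i, (i < size s) && (u \in bag i) by exists j; rewrite js.
  have ubP i : (i < size s) && (u \in bag i) -> i <= size s by case/andP=> /ltnW.
  case: (ex_maxnP exP ubP) => i /andP[lti ui] maxi.
  exists i; split=> //; last by apply: maxi; rewrite js.
  rewrite /ends lti; apply/exists_inP; exists u; rewrite // ui.
  apply/allP => l; rewrite mem_iota => /andP[il ls]; apply/negP => ul.
  by have := maxi l; rewrite ul andbT; lia.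
have [v0 v0W] := set0Pn _ W0; have [tv v0t] := covW v0 v0W.
have exE : exists i, ends i.
  have [||i [ei _ _]] := ends_after v0 (index tv s) v0W; rewrite ?index_lt //.
    by rewrite -bag_index.
  by exists i.
case: (ex_minnP exE) => i /andP[lti /exists_inP[v vW /andP[vi /allP vafter]]] mini.
(* No vertex of [W] ends before [i], so one that occurs earlier lasts up to [i]. *)
have toi u j : u \in W -> j <= i -> u \in bag j -> u \in bag i.
  move=> uW ji uj; have [|l [el jl ul]] := ends_after u j uW _ uj.
    exact: leq_ltn_trans lti.
  apply: (bag_interval ji (mini l el) _ uj ul).
  by case/andP: el.
have before s' : v \in B s' -> index s' s <= i.
  rewrite bag_index leqNgt => vs'; apply/negP => lt.
  have := vafter (index s' s); rewrite mem_iota vs' lt subnKC //.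
  by rewrite index_lt => /(_ isT).
have outside s' w : v \in B s' -> w \in B s' -> w \notin bag i ->
    w \notin W /\ forall s'', w \in B s'' -> index s'' s < i.
  move=> vs' ws' wi; have le := before s' vs'.
  split; first by apply: contra wi => wW; apply: (toi w _ wW le); rewrite -bag_index.
  move=> s'' ws''; rewrite ltnNge; apply: contra wi => le'.
  by apply: (bag_interval le le' (index_lt s'')); rewrite -bag_index.
pose mixed j := (j < i) && ~~ (bag j \subset W).
have [/existsP[j0 mj0] | nomix] := boolP [exists j : 'I_i, mixed j]; last first.
  (* Without mixed bags no such [w] arises; [[set v]] fits since [k] is positive. *)
  exists (nth t0 s i), v, [set v]; rewrite inE eqxx sub1set cards1; split=> //.
  move=> s' vs' w ws' wi; have [wW lt] := outside s' w vs' ws' wi.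
  case/existsP: nomix; exists (Ordinal (lt s' ws')); rewrite /mixed /= lt //=.
  by apply/subsetPn; exists w; rewrite // -bag_index.
have ubm j : mixed j -> j <= i by case/andP=> /ltnW.
case: (ex_maxnP (ex_intro _ (val j0) mj0) ubm) => j /andP[ji jW] maxj.
have jle s' w : w \in B s' -> w \notin W -> index s' s < i -> index s' s <= j.
  move=> ws' wW lt; apply: maxj; rewrite /mixed lt; apply/subsetPn; exists w => //.
  by rewrite -bag_index.
have toj u s' : u \in W -> u \in B s' -> index s' s <= j -> u \in bag j.
  move=> uW us' le; apply: (bag_interval le (ltnW ji) lti).
    by rewrite -bag_index.
  apply: (toi u (index s' s)) => //; last by rewrite -bag_index.
  exact: leq_trans le (ltnW ji).
(* That [v] lies in [bag j] is derived from such [s'] and [w]; if there are none, [[set v]] serves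
   again. *)
have [/existsP[s' /existsP[w /and3P[vs' ws' wi]]] | none] :=
  boolP [exists s', exists w, [&& v \in B s', w \in B s' & w \notin bag i]];
  last first.
  exists (nth t0 s i), v, [set v]; rewrite inE eqxx sub1set cards1; split=> //.
  move=> s' vs' w ws' wi; case/existsP: none; exists s'; apply/existsP; exists w.
  by rewrite vs' ws'.
exists (nth t0 s i), v, (bag j :&: W); split=> //.
- have [wW lt] := outside s' w vs' ws' wi.
  by rewrite inE vW (toj v s') // (jle s' w) ?lt.
- apply/subsetP => u; rewrite inE => /andP[uj uW].
  exact: toi uW (ltnW ji) uj.
(* One of the at most [k + 1] vertices of [bag j] lies outside [W]. *)
- rewrite -ltnS; apply: leq_trans (width (nth t0 s j)); apply: proper_card.
  rewrite properE subsetIl; apply: contra jW => sub.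
  by apply: subset_trans sub (subsetIr _ _).
move=> s1 vs1 w1 ws1 w1i; have [w1W lt] := outside s1 w1 vs1 ws1 w1i.
split=> // s2 ws2; apply/subsetP => u; rewrite !inE => /andP[us2 uW].
by rewrite uW andbT; apply: (toj u s2) => //; apply: (jle s2 w1) => //; apply: lt.
Qed.

End Paths.

(** * The three cases *)

Lemma edges_mem (G : sgraph) (u w : G) : ([set u; w] \in edges G) = adj u w.
Proof.
apply/imsetP/idP => [[[x y] /=] | uw]; last by exists (u, w); rewrite ?inE.
rewrite inE /= => xy /setP e.
have := (e u, e w, e x, e y); rewrite !inE !eqxx ?orbT /= => -[[[eu ew]]].
case/orP=> /eqP ex /orP[]/eqP ey; rewrite ex ey in xy eu ew.
- by rewrite adj_irr in xy.
- by [].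
- by rewrite adj_sym.
- by rewrite adj_irr in xy.
Qed.

Lemma edges_card (G : sgraph) : {in edges G, forall a : {set G}, #|a| = 2}.
Proof.
move=> a /imsetP[[x y]]; rewrite inE /= => xy ->; rewrite cards2.
by case: eqP xy => // ->; rewrite adj_irr.
Qed.

Lemma degree_edges (G : sgraph) (u : G) : degree (edges G) u <= max_degree G.
Proof.
rewrite degree_nbr; last exact: edges_card.
have -> : #|nbr (edges G) u| = #|[set w | adj u w]|.
  by apply: eq_card => w; rewrite !inE edges_mem.
exact: (leq_bigmax (F := fun u : G => #|[set w | adj u w]|)).
Qed.

(** If all lists are [I_k], the edges at one vertex need distinct colours below [k]. *)
Lemma edge_choosable_ge (G : sgraph) k : edge_choosable G k -> max_degree G <= k.
Proof.
move=> chG; apply/bigmax_leqP => v _.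
have [a _ | C [CL Cadj]] := chG (fun=> `I_k); first exact: card_lexx.
rewrite cardE -(size_map (fun w => C [set v; w])) -(size_iota 0 k).
apply: uniq_leq_size.
  rewrite map_inj_in_uniq ?enum_uniq // => w w'; rewrite !mem_enum !inE => vw vw'.
  apply: contra_eq => ww'; apply: Cadj; rewrite ?edges_mem //.
    apply: contraNneq ww' => /setP/(_ w); rewrite !inE eqxx orbT => /esym/orP[]//.
    by move=> /eqP e; rewrite e adj_irr in vw.
  by apply/set0Pn; exists v; rewrite !inE eqxx.
move=> c /mapP[w]; rewrite mem_enum inE => vw ->.
by rewrite mem_iota; apply: CL; rewrite edges_mem.
Qed.

Lemma list_colourable_choosable (G : sgraph) k :
  list_colourable (edges G) k -> edge_choosable G k.
Proof.
move=> lc L HL.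
have exs a : exists s : seq nat, a \in edges G ->
    [/\ uniq s, size s = k & forall c, c \in s -> L a c].
  have [aG | //] := boolP (a \in edges G); last by exists [::].
  have /pcard_leP[f] := HL a aG; exists (map f (iota 0 k)) => _; split.
  - rewrite map_inj_in_uniq ?iota_uniq // => i j.
    by rewrite !mem_iota => hi hj; apply: (@inj _ _ _ f); exact: mem_set.
  - by rewrite size_map size_iota.
  - by move=> c /mapP[i]; rewrite mem_iota => hi ->; apply: funS.
have [s sP] := choice exs.
have [a aG | C [CL Cadj]] := lc s; first by have [us <- _] := sP a aG.
by exists C; split=> // a aG; have [_ _] := sP a aG; apply; apply: CL.
Qed.

Section Assembly.

Variables (G : sgraph) (D : nat).
Hypothesis maxG : max_degree G <= D.

(** By induction on [#|F|], all proper subsets are colourable; a light edge would make [F]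
    colourable as well, so [step] may assume heavy edges. *)
Lemma minimal_choosable :
  (forall F : {set {set G}}, F != set0 -> F \subset edges G ->
    (forall H : {set {set G}}, H \proper F -> list_colourable H D) ->
    (forall u w, [set u; w] \in F -> D.+2 <= degree F u + degree F w) ->
    list_colourable F D) -> edge_choosable G D.
Proof.
move=> step; apply: list_colourable_choosable.
move: (subxx (edges G)); move: {1 3}(edges G) => F.
have [n] := ubnP #|F|; elim: n F => // n IHn F leFn FG.
have [-> | F0] := eqVneq F set0.
  by move=> L _; exists (fun=> 0); split=> a; rewrite inE.
have minF (H : {set {set G}}) : H \proper F -> list_colourable H D.
  move=> HF; apply: IHn (subset_trans (proper_sub HF) FG).
  exact: leq_trans (proper_card HF) _.
have cardF : {in F, forall a : {set G}, #|a| = 2}.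
  by move=> a /(subsetP FG)/edges_card.
case: (pselect (list_colourable F D)) => // nlc; apply: step => // u w uw.
by rewrite ltnNge; apply/negP => le; apply: nlc; apply: (light_edge cardF minF uw le).
Qed.

Section Step.

Variables (F : {set {set G}}) (T : sgraph) (B : T -> {set G}) (k : nat).
Hypotheses (FG : F \subset edges G) (width : has_width B k).
Hypothesis edge_bag : forall v w : G, adj v w ->
  exists t : T, (v \in B t) && (w \in B t).
Hypothesis heavy : forall u w, [set u; w] \in F ->
  D.+2 <= degree F u + degree F w.
Hypothesis k_small : k + k <= D.+1.

Definition big_vertices := [set u | k < degree F u].

(** Two small ends would have degree sum at most [k + k], less than [D + 2]. *)
Lemma big_edge u w : [set u; w] \in F -> u \notin big_vertices -> w \in big_vertices.
Proof. by move/heavy; rewrite !inE; lia. Qed.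

Lemma big_vertices_neq0 : F != set0 -> big_vertices != set0.
Proof.
case/set0Pn=> a aF; have /imsetP[[u w]] := subsetP FG a aF.
rewrite inE /= => _ ea; apply/set0Pn; rewrite ea in aF.
by have [ub | /(big_edge aF)] := boolP (u \in big_vertices); [exists u | exists w].
Qed.

(** A neighbour w of v outside [B t] is small, so its neighbours are big; each shares a bag with w,
    and the last hypothesis puts it into [X]. *)
Lemma deepest_configuration t v (X : {set G}) :
  v \in big_vertices -> v \in X -> X \subset B t ->
  (forall s, v \in B s -> forall w, w \in B s -> w \notin B t ->
     w \notin big_vertices /\ forall s', w \in B s' -> B s' :&: big_vertices \subset X) ->
  [/\ uniq (v :: enum (X :\ v)), (size (enum (X :\ v))).+1 = #|X|,
      [/\ #|B t :\ v| <= k, {subset enum (X :\ v) <= B t :\ v} &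
          k < degree F v] &
      forall w, w \in nbr F v -> w \notin B t :\ v ->
        degree F w <= k /\ {subset nbr F w <= v :: enum (X :\ v)}].
Proof.
move=> vb vX Xt outside.
have adjF x y : y \in nbr F x -> adj x y.
  by rewrite inE => /(subsetP FG); rewrite edges_mem.
split.
- by rewrite /= mem_enum !inE eqxx enum_uniq.
- by rewrite -cardE (cardsD1 v X) vX.
- split; [| | by move: vb; rewrite inE].
    by have := width t; rewrite (cardsD1 v) (subsetP Xt) //.
  by move=> x; rewrite mem_enum !inE => /andP[-> /(subsetP Xt)].
move=> w vw; rewrite !inE negb_and negbK.
have wv : w != v by apply: contraTneq (adjF _ _ vw) => ->; rewrite adj_irr.
rewrite (negPf wv) /= => wt; have [s /andP[vs ws]] := edge_bag (adjF _ _ vw).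
have [wb sub] := outside s vs w ws wt; split; first by move: wb; rewrite inE -leqNgt.
move=> x wx; have [s' /andP[ws' xs']] := edge_bag (adjF _ _ wx).
have xX : x \in X.
  apply: (subsetP (sub s' ws')); rewrite inE xs'.
  by apply: (big_edge _ wb); rewrite inE in wx.
by rewrite inE mem_enum !inE xX andbT; case: eqVneq.
Qed.

End Step.

Lemma tree_connected (T : sgraph) : is_tree T -> connected_in [set: T].
Proof.
case=> _ con _ x y _ _; have /connectP[p pp ->] := con x y.
by case/shortenP: pp => q pq uq _; exists q => //; split=> // z _; rewrite inE.
Qed.

Lemma treewidth3_choosable : has_tree_decomposition G 3 -> 7 <= D ->
  edge_choosable G D.
Proof.
case=> T [B [[treeT covB edgeB interB] width]] leD.
apply: minimal_choosable => F F0 FG minF heavy.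
have k_small : 3 + 3 <= D.+1 by lia.
have [_ _ acyc] := treeT.
have [|t [v [vb vt out]]] := tree_deepest acyc interB (tree_connected treeT)
    (big_vertices_neq0 FG heavy k_small F0).
  by move=> u _; have [t ut] := covB u; exists t.
(* For trees [X] is the whole bag, which leaves up to three x; the path case saves one. *)
have [|uvx sx [cZ xZ bigv] nbrv] :=
    deepest_configuration FG width edgeB heavy k_small vb vt (subxx _).
  move=> s vs w ws wt; have [//|wb sub] := out s _ vs w ws wt.
  by split=> // s' ws'; apply: sub.
have cardF : {in F, forall a : {set G}, #|a| = 2}.
  by move=> a /(subsetP FG)/edges_card.
have degF u : degree F u <= D.
  exact: leq_trans (degree_subset u FG) (leq_trans (degree_edges u) maxG).
have x3 : size (enum (B t :\ v)) <= 3 by rewrite -cardE.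
by apply: (tree_case cardF minF uvx x3 degF cZ xZ bigv nbrv heavy) => //; rewrite cardE.
Qed.

Lemma pathwidth_configuration k (F : {set {set G}}) :
  0 < k -> k + k <= D.+1 -> has_path_decomposition G k ->
  F != set0 -> F \subset edges G ->
  (forall u w, [set u; w] \in F -> D.+2 <= degree F u + degree F w) ->
  exists v xs (Z : {set G}), [/\ uniq (v :: xs), (size xs).+1 <= k,
      [/\ #|Z| <= k, {subset xs <= Z} & k < degree F v] &
      forall w, w \in nbr F v -> w \notin Z ->
        degree F w <= k /\ {subset nbr F w <= v :: xs}].
Proof.
move=> k0 k_small [T [B [[treeT covB edgeB interB] pathT width]]] F0 FG heavy.
have [/card_gt0P[t0 _] [s [us sT adjT]]] := pathT.
have [|t [v [X [vb vX Xt cX out]]]] := path_deepest t0 us sT adjT interB width k0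
    (big_vertices_neq0 FG heavy k_small F0).
  by move=> u _; have [t ut] := covB u; exists t.
have [uvx sx ? ?] :=
    deepest_configuration FG width edgeB heavy k_small vb vX Xt out.
by exists v, (enum (X :\ v)), (B t :\ v); split; rewrite ?sx.
Qed.

Lemma pathwidth3_choosable : has_path_decomposition G 3 -> 6 <= D ->
  edge_choosable G D.
Proof.
move=> pw leD; apply: minimal_choosable => F F0 FG minF heavy.
have k_small : 3 + 3 <= D.+1 by lia.
have [v [xs [Z [uvx sx [cZ xZ bigv] nbrv]]]] :=
  pathwidth_configuration (k := 3) isT k_small pw F0 FG heavy.
have cardF : {in F, forall a : {set G}, #|a| = 2}.
  by move=> a /(subsetP FG)/edges_card.
have degF u : degree F u <= D.
  exact: leq_trans (degree_subset u FG) (leq_trans (degree_edges u) maxG).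
exact: (path3_case cardF minF uvx (ltnW sx) degF cZ xZ bigv nbrv heavy).
Qed.

Lemma pathwidth4_choosable : has_path_decomposition G 4 -> 10 <= D ->
  edge_choosable G D.
Proof.
move=> pw leD; apply: minimal_choosable => F F0 FG minF heavy.
have k_small : 4 + 4 <= D.+1 by lia.
have [v [xs [Z [uvx sx [cZ xZ bigv] nbrv]]]] :=
  pathwidth_configuration (k := 4) isT k_small pw F0 FG heavy.
have cardF : {in F, forall a : {set G}, #|a| = 2}.
  by move=> a /(subsetP FG)/edges_card.
have degF u : degree F u <= D.
  exact: leq_trans (degree_subset u FG) (leq_trans (degree_edges u) maxG).
exact: (path4_case cardF minF uvx sx degF cZ xZ bigv nbrv heavy).
Qed.

End Assembly.

Lemma treewidthP (G : sgraph) k : treewidth G <= k -> has_tree_decomposition G k.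
Proof.
rewrite /treewidth; case: ex_minnP => k0 /asboolP[T [B [dB wB]]] _ le.
by exists T, B; split=> // t; apply: leq_trans (wB t) _.
Qed.

Lemma pathwidthP (G : sgraph) k : pathwidth G <= k -> has_path_decomposition G k.
Proof.
rewrite /pathwidth; case: ex_minnP => k0 /asboolP[T [B [dB pT wB]]] _ le.
by exists T, B; split=> // t; apply: leq_trans (wB t) _.
Qed.

Theorem theorem1 (G : sgraph) (Delta : nat) (hDelta : max_degree G = Delta) :
  [\/ treewidth G <= 3 /\ 7 <= Delta,
      pathwidth G <= 3 /\ 6 <= Delta |
      pathwidth G <= 4 /\ 10 <= Delta] ->
  list_chromatic_index G = Delta.
Proof.
move=> cases; have maxG : max_degree G <= Delta by rewrite hDelta.
have chG : edge_choosable G Delta.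
  case: cases => -[].
  - by move/treewidthP; apply: treewidth3_choosable.
  - by move/pathwidthP; apply: pathwidth3_choosable.
  - by move/pathwidthP; apply: pathwidth4_choosable.
rewrite /list_chromatic_index; case: ex_minnP => k /asboolP chk mink.
apply/eqP; rewrite eqn_leq mink; last exact/asboolP.
by rewrite -hDelta edge_choosable_ge.
Qed.
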